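(* Let $(M^n,g)$ be any Hermitian manifold, and let $\nabla^+=2\nabla-\nabla^s$ and $\nabla^-=2\nabla^c-\nabla^+=2\nabla^c+\nabla^s-2\nabla$. Then $\nabla^+$ is Kähler-like if and only if the Strominger connection $\nabla^s$ is Kähler-like; likewise, $\nabla^-$ is Kähler-like if and only if $\nabla^s$ is Kähler-like.
   Context: Let $(M^n,g)$ be a Hermitian manifold with complex structure $J$ and Riemannian (Levi-Civita) connection $\nabla$. The Chern connection $\nabla^c$ is the unique connection $D$ with $Dg=0$, $DJ=0$ whose torsion has no $(1,1)$-component. The Strominger (Bismut) connection $\nabla^s$ is the unique connection $D$ with $Dg=0$, $DJ=0$ whose torsion is totally skew-symmetric (i.e. $g(T^D(x,y),z)$ is a $3$-form). With $D^{r}=\frac{1+r}{2}\nabla^c+\frac{1-r}{2}\nabla^s$ and $D^r_s=(1-s)D^r+s\nabla$, one has $\nabla^+=D^{-1}_{2}$ and $\nabla^-=D^{1/3}_{-2}$. A connection $D$ with $Dg=0$ (not necessarily $DJ=0$) is called Kähler-like if its curvature tensor $R^D(x,y,z,w)=g(R^D(x,y)z,w)$ satisfies, for all real tangent vectors $x,y,z,w$: $R^D(x,y,z,w)+R^D(y,z,x,w)+R^D(z,x,y,w)=0$ and $R^D(Jx,Jy,z,w)=R^D(x,y,z,w)=R^D(x,y,Jz,Jw)$. *)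

(* Defs.v *)
From mathcomp Require Import all_boot all_order all_algebra.
From mathcomp Require Import all_classical all_reals all_analysis.
Set Implicit Arguments.
Unset Strict Implicit.
Unset Printing Implicit Defensive.
Import Order.TTheory GRing.Theory Num.Theory.
Import numFieldNormedType.Exports.
Local Open Scope classical_set_scope.
Local Open Scope ring_scope.

(* C^k and C^infinity on an open subset [A] of a finite-dimensional space [V];
   [f] is total, its values off [A] are irrelevant. *)
Fixpoint Ck (R : realType) (V W : normedModType R) (k : nat) (A : set V)
    (f : V -> W) : Prop :=
  match k with
  | 0%N => forall x, A x -> {for x, continuous f}
  | k'.+1 => (forall x, A x -> differentiable f x) /\
             forall v, Ck k' A ('D_v f)
  end.

Definition smooth (R : realType) (V W : normedModType R) (A : set V)
    (f : V -> W) : Prop := forall k, Ck k A f.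

(* C^n is identified with R^n x R^n through z = x + iy |-> (x, y), and [Jmul]
   is multiplication by i. *)
Notation model R n := 'rV[R]_(n + n) (only parsing).

Definition Jmul (R : realType) (n : nat) (v : model R n) : model R n :=
  row_mx (- rsubmx v) (lsubmx v).

(* [param] is the inverse of [coord] on the image [cod]. *)
Record chart (R : realType) (n : nat) (M : topologicalType) := Chart {
  dom : set M;
  coord : M -> model R n;
  param : model R n -> M;
  cod : set (model R n) := coord @` dom;
  dom_open : open dom;
  cod_open : open cod;
  coordK : forall p, dom p -> param (coord p) = p;
  coord_continuous : forall p, dom p -> {for p, continuous coord};
  param_continuous : forall x, cod x -> {for x, continuous param} }.

Section Transition.
Context {R : realType} {n : nat} {M : topologicalType}.
Implicit Types c d : chart R n M.

Definition transition c d : model R n -> model R n := coord d \o param c.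
Definition overlap c d : set (model R n) := coord c @` (dom c `&` dom d).

End Transition.

(* The last axiom is the system of Cauchy-Riemann equations. *)
Record complexManifold (R : realType) (n : nat) (M : topologicalType) :=
  ComplexManifold {
    atlas : Type;
    ch : atlas -> chart R n M;
    manifold_hausdorff : hausdorff_space M;
    manifold_second_countable : @second_countable M;
    atlas_cover : forall p, exists c, dom (ch c) p;
    transition_smooth : forall c d,
      smooth (overlap (ch c) (ch d)) (transition (ch c) (ch d));
    transition_holomorphic : forall c d x, overlap (ch c) (ch d) x ->
      forall v, 'D_(Jmul v) (transition (ch c) (ch d)) x =
                Jmul ('D_v (transition (ch c) (ch d)) x) }.

Definition bilin (R : realType) (m : nat) (G : 'M[R]_m) (u v : 'rV[R]_m) : R :=
  (u *m G *m v^T) 0 0.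

(* A tangent vector at a point is given by its components in a chart.  Since
   the charts are holomorphic, the complex structure J of the manifold has the
   constant expression [Jmul] in each of them. *)
Record hermitianMetric (R : realType) (n : nat) (M : topologicalType)
    (X : complexManifold R n M) := HermitianMetric {
  metric : atlas X -> model R n -> 'M[R]_(n + n);
  metric_smooth : forall c, smooth (cod (ch c)) (metric c);
  metric_sym : forall c x, cod (ch c) x ->
    forall u v, bilin (metric c x) u v = bilin (metric c x) v u;
  metric_pos : forall c x, cod (ch c) x ->
    forall u, u != 0 -> 0 < bilin (metric c x) u u;
  metric_J : forall c x, cod (ch c) x ->
    forall u v,
      bilin (metric c x) (Jmul u) (Jmul v) = bilin (metric c x) u v;
  metric_transition : forall c d x, overlap (ch c) (ch d) x ->
    forall u v, let t := transition (ch c) (ch d) in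
      bilin (metric c x) u v = bilin (metric d (t x)) ('D_u t x) ('D_v t x) }.

Section ChristoffelContraction.
Context {R : realType} {m : nat}.

(* [G i j] is the field D_{e_i} e_j of a connection D. *)
Definition contract (G : 'I_m -> 'I_m -> 'rV[R]_m -> 'rV[R]_m)
    (x u v : 'rV[R]_m) : 'rV[R]_m :=
  \sum_i \sum_j (u 0 i * v 0 j) *: G i j x.

End ChristoffelContraction.

(* An affine connection on the tangent bundle of the underlying real manifold,
   through its Christoffel symbols and their transformation law. *)
Record connection (R : realType) (n : nat) (M : topologicalType)
    (X : complexManifold R n M) := Connection {
  christoffel : atlas X ->
    'I_(n + n) -> 'I_(n + n) -> model R n -> model R n;
  christoffel_smooth : forall c i j, smooth (cod (ch c)) (christoffel c i j);
  christoffel_transition : forall c d x, overlap (ch c) (ch d) x ->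
    forall u v, let t := transition (ch c) (ch d) in
      'D_(contract (christoffel c) x u v) t x =
      'D_u ('D_v t) x
      + contract (christoffel d) (t x) ('D_u t x) ('D_v t x) }.

Section Affine.
Context {R : realType}.

Lemma near_eq_diff (V W : normedModType R) (f g : V -> W) x :
  {near x, f =1 g} -> differentiable f x -> differentiable g x.
Proof.
move=> fg /diff_locallyP[dfc dfo].
have go : g \o shift x = cst (g x) + 'd f x +o_ 0 id.
  have fg0 : \forall h \near (0 : V), f (h + x) = g (h + x).
    have := fg; rewrite [X in X -> _](near_shift 0) /= subr0; exact.
  apply/eqaddoP => e e0; have /eqaddoP /(_ e e0) := dfo.
  apply: filterS2 fg0 => h fgh.
  by rewrite !fctE /= fgh (nbhs_singleton fg).
by apply/diff_locallyP; rewrite (diff_unique dfc go).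
Qed.

Lemma Ck_eq (V W : normedModType R) k (A : set V) (f g : V -> W) : open A ->
  (forall x, A x -> f x = g x) -> Ck k A f -> Ck k A g.
Proof.
move=> oA fg.
have nfg x : A x -> {near x, f =1 g}.
  by move=> Ax; near=> y; apply: fg; near: y; exact: open_nbhs_nbhs.
elim: k f g fg nfg => [|k IH] f g fg nfg /=.
  move=> cf x Ax; rewrite /prop_for /continuous_at -fg //.
  by apply: cvg_trans (cf x Ax); apply: near_eq_cvg; exact: nfg.
move=> [df dvf]; split=> [x Ax|v].
  by apply: (near_eq_diff (nfg x Ax)); exact: df.
have e x : A x -> 'D_v f x = 'D_v g x.
  by move=> Ax; exact: (near_eq_derive v (nfg x Ax)).
apply: IH (dvf v) => // x Ax; near=> y; apply: e; near: y.
exact: open_nbhs_nbhs.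
Unshelve. all: by end_near.
Qed.

Lemma Ck_lin (V W : normedModType R) k (A : set V) (f g : V -> W) (a b : R) :
  open A -> Ck k A f -> Ck k A g -> Ck k A (fun x => a *: f x + b *: g x).
Proof.
move=> oA; elim: k f g => [|k IH] f g /=.
  by move=> cf cg x Ax; apply: cvgD; apply: cvgZl_tmp; [exact: cf|exact: cg].
move=> [df dvf] [dg dvg].
have hf x : A x -> differentiable (a \*: f) x.
  by move=> Ax; apply: differentiableZ; exact: df.
have hg x : A x -> differentiable (b \*: g) x.
  by move=> Ax; apply: differentiableZ; exact: dg.
split=> [x Ax|v]; first exact: differentiableD (hf x Ax) (hg x Ax).
apply: Ck_eq (IH _ _ (dvf v) (dvg v)) => // x Ax.
have df' : derivable f x v by apply: diff_derivable; exact: df.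
have dg' : derivable g x v by apply: diff_derivable; exact: dg.
have -> : (fun y => a *: f y + b *: g y) = a \*: f + b \*: g by [].
by rewrite deriveD ?deriveZ//; exact: derivableZ.
Qed.

Lemma derive_lin (V W : normedModType R) (f : V -> W) x (a b : R) (u v : V) :
  differentiable f x -> 'D_(a *: u + b *: v) f x = a *: 'D_u f x + b *: 'D_v f x.
Proof. by move=> df; rewrite !deriveE // linearD !linearZ. Qed.

Lemma contract_lin (m : nat)
    (G H : 'I_m -> 'I_m -> 'rV[R]_m -> 'rV[R]_m) (a b : R) x u v :
  contract (fun i j y => a *: G i j y + b *: H i j y) x u v =
  a *: contract G x u v + b *: contract H x u v.
Proof.
rewrite /contract !scaler_sumr -big_split; apply: eq_bigr => i _ /=.
rewrite !scaler_sumr -big_split; apply: eq_bigr => j _ /=.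
by rewrite scalerDr !scalerA ![_ * (u 0 i * _)]mulrC.
Qed.

Context {n : nat} {M : topologicalType} {X : complexManifold R n M}.

Definition affine_christoffel (s : R) (D0 D1 : connection X) (c : atlas X)
    (i j : 'I_(n + n)) (x : model R n) : model R n :=
  (1 - s) *: christoffel D0 c i j x + s *: christoffel D1 c i j x.

Lemma affine_smooth s D0 D1 c i j :
  smooth (cod (ch c)) (affine_christoffel s D0 D1 c i j).
Proof.
by move=> k; apply: Ck_lin; [exact: cod_open|exact: christoffel_smooth..].
Qed.

Lemma affine_transition s D0 D1 (c d : atlas X) x :
  overlap (ch c) (ch d) x ->
  forall u v, let t := transition (ch c) (ch d) in
    'D_(contract (affine_christoffel s D0 D1 c) x u v) t x =
    'D_u ('D_v t) x
    + contract (affine_christoffel s D0 D1 d) (t x) ('D_u t x) ('D_v t x).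
Proof.
move=> xcd u v t; rewrite !contract_lin derive_lin; last first.
  by have [h _] := @transition_smooth _ _ _ X c d 1%N; apply: h.
rewrite !christoffel_transition // -/t !scalerDr addrACA -scalerDl.
by rewrite subrK scale1r.
Qed.

(* The affine combination (1 - s) D0 + s D1. *)
Definition affine (s : R) (D0 D1 : connection X) : connection X :=
  Connection (@affine_smooth s D0 D1) (@affine_transition s D0 D1).

End Affine.

Section Tensors.
Context {R : realType} {n : nat} {M : topologicalType}.
Context {X : complexManifold R n M} (g : hermitianMetric X) (D : connection X).
Implicit Types (c : atlas X) (x : model R n).

(* In what follows vector fields are given by their expressions on the codomain
   of a chart. *)
Definition cov c (Y Z : model R n -> model R n) x : model R n :=
  'D_(Y x) Z x + contract (christoffel D c) x (Y x) (Z x).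

Definition bracket (Y Z : model R n -> model R n) x : model R n :=
  'D_(Y x) Z x - 'D_(Z x) Y x.

Definition torsion c (Y Z : model R n -> model R n) x : model R n :=
  cov c Y Z x - cov c Z Y x - bracket Y Z x.

Definition curvature c (Y Z W : model R n -> model R n) x : model R n :=
  cov c Y (cov c Z W) x - cov c Z (cov c Y W) x - cov c (bracket Y Z) W x.

(* Values of the two tensors on tangent vectors, which by tensoriality may be
   computed on any local extension, here the one with constant components. *)
Definition tors c x (u v : model R n) : model R n :=
  torsion c (cst u) (cst v) x.

Definition curv c x (u v w z : model R n) : R :=
  bilin (metric g c x) (curvature c (cst u) (cst v) (cst w) x) z.

(* Dg = 0 *)
Definition preserves_metric : Prop :=
  forall c (Y Z : model R n -> model R n),
  smooth (cod (ch c)) Y -> smooth (cod (ch c)) Z ->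
  forall x, cod (ch c) x -> forall u,
    'D_u (fun y => bilin (metric g c y) (Y y) (Z y)) x =
    bilin (metric g c x) (cov c (cst u) Y x) (Z x)
    + bilin (metric g c x) (Y x) (cov c (cst u) Z x).

(* DJ = 0 *)
Definition preserves_J : Prop :=
  forall c (Y : model R n -> model R n), smooth (cod (ch c)) Y ->
  forall x, cod (ch c) x -> forall u,
    cov c (cst u) (fun y => Jmul (Y y)) x = Jmul (cov c (cst u) Y x).

Definition torsion_free : Prop :=
  forall c x, cod (ch c) x -> forall u v, tors c x u v = 0.

(* The vanishing, for the complex bilinear extension of the torsion T, of
   T(u - iJu, v + iJv)
     = (T(u, v) + T(Ju, Jv)) + i (T(u, Jv) - T(Ju, v)). *)
Definition torsion_no_11 : Prop :=
  forall c x, cod (ch c) x -> forall u v,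
    tors c x u v + tors c x (Jmul u) (Jmul v) = 0 /\
    tors c x u (Jmul v) - tors c x (Jmul u) v = 0.

Definition torsion_skew : Prop :=
  forall c x, cod (ch c) x -> forall u v w,
    let T u v w := bilin (metric g c x) (tors c x u v) w in
    T v u w = - T u v w /\ T u w v = - T u v w.

Definition levi_civita : Prop := preserves_metric /\ torsion_free.

Definition chern : Prop := [/\ preserves_metric, preserves_J & torsion_no_11].

Definition strominger : Prop :=
  [/\ preserves_metric, preserves_J & torsion_skew].

Definition kahler_like : Prop :=
  preserves_metric /\
  forall c x, cod (ch c) x -> forall u v w z,
    [/\ curv c x u v w z + curv c x v w u z + curv c x w u v z = 0,
        curv c x (Jmul u) (Jmul v) w z = curv c x u v w z &
        curv c x u v w z = curv c x u v (Jmul w) (Jmul z)].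

End Tensors.

Section PlusMinus.
Context {R : realType} {n : nat} {M : topologicalType}.
Context {X : complexManifold R n M}.

(* 2 LC - St *)
Definition nabla_plus (LC St : connection X) : connection X := affine 2 St LC.

(* 2 Ch - nabla_plus *)
Definition nabla_minus (LC Ch St : connection X) : connection X :=
  affine 2 (nabla_plus LC St) Ch.

Lemma affine2E (D0 D1 : connection X) c i j x :
  christoffel (affine 2 D0 D1) c i j x =
  2 *: christoffel D1 c i j x - christoffel D0 c i j x.
Proof.
rewrite /= /affine_christoffel addrC; congr (_ + _).
by rewrite -[2]/(1 + 1) opprD addrA subrr add0r scaleN1r.
Qed.

Lemma nabla_minusE (LC Ch St : connection X) c i j x :
  christoffel (nabla_minus LC Ch St) c i j x =
  2 *: christoffel Ch c i j x + christoffel St c i j x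
  - 2 *: christoffel LC c i j x.
Proof. by rewrite !affine2E opprB addrA. Qed.

End PlusMinus.

(* Main.v *)
Require Import Defs.
From mathcomp Require Import all_boot all_order all_algebra.
From mathcomp Require Import all_classical all_reals all_analysis.
From mathcomp Require Import ring lra.
Set Implicit Arguments.
Unset Strict Implicit.
Unset Printing Implicit Defensive.
Import Order.TTheory GRing.Theory Num.Theory.
Import numFieldNormedType.Exports.
Local Open Scope classical_set_scope.
Local Open Scope ring_scope.

(* Write D for the Strominger connection, T for its torsion, so that g(T(x,y),z)
   is a 3-form, and K = DT.  Let Jac(x,y,z) be the cyclic sum of T(T(x,y),z) and
   Theta(x,y)z = K(x,y,z) - K(y,x,z) + Jac(x,y,z).  Then D - T = nabla^+ has
   curvature R - Theta and D + J T(., J.) = nabla^- has R + J Theta J.  If one of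
   them is Kaehler-like, J-invariance in the last two arguments makes the two
   curvatures equal; the Bianchi identity gives K = -(2/3) Jac, so that
   Theta = -(1/3) Jac is a 4-form commuting with J, which vanishes.

   Conversely let D be Kaehler-like.  Then K = -(1/3) Jac, and it remains to see
   that Jac = 0.  The (2,1) part of T is a complex Lie bracket L on each tangent
   space, N u is the adjoint of L u, and Jac reduces to its (2,2) part phi, a
   self-adjoint operator on bivectors.  The Ricci identity for L and the
   derivative of the Jacobi identity give ad_k phi = -2 phi ad_k on bivectors.
   Differentiating once more and taking traces yields
   6 sum |N_k phi|^2 = -9 sum |ad_k^* phi|^2, so both sides vanish; this implies
   N_k phi = L_k phi = 0, and then phi = 0. *)

(** * Symmetry of second derivatives *)

(** Nothing can be integrated over M, so positivity has to come from a pointwise identity whose two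
    sides have opposite signs. The difficulty is that differentiating a relation on phi brings in D
    phi, of which only the J-antilinear part in the direction of derivation is under control:
    J-invariance of the curvature turns the Ricci identity for L into a statement about that part
    alone, and with the differentiated Jacobi identity it evaluates it to -ad_a^* phi. The
    derivative of ad_k phi = -2 phi ad_k is therefore used only through its antilinear part, where
    no derivative of phi is left and a commutator of ad_k and ad_a^* stands against terms quadratic
    in phi. The factor -2 decides the sign: it makes the traced commutator proportional to 1 - 4.
    The factors 1/3 all come from D_a L = phi(., ., a) / 3, a consequence of K = -(1/3) Jac; [dphi]
    and [M] absorb them. *)

Section Schwarz.
Context {R : realType} {V : normedModType R}.

Lemma is_derive_line (f : V -> R) (p u : V) (s : R) :
  derivable f (p + s *: u) u ->
  is_derive s 1 (fun r : R => f (p + r *: u)) ('D_u f (p + s *: u)).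
Proof.
move=> df.
have e : (fun h : R => h^-1 *: (((fun r : R => f (p + r *: u)) \o shift s)
             (h *: 1) - f (p + s *: u))) =
         (fun h : R => h^-1 *: ((f \o shift (p + s *: u)) (h *: u)
             - f (p + s *: u))).
  apply/funext => h /=; rewrite /shift /=; congr (_ *: (f _ - _)).
  by rewrite scalerDl scaler1 addrCA addrA.
by split; rewrite /derivable /derive e.
Qed.

(** The mean value theorem applies to s |-> f(p + t v + s u) - f(p + s u) on [0, t]. Its derivative
    is a difference of two values of ['D_u f], which differentiability of ['D_u f] at [p] linearizes
    up to o(t). *)
Lemma second_difference (f : V -> R) (p u v : V) :
  (\forall x \near p, differentiable f x) -> differentiable ('D_u f) p ->
  forall e : R, 0 < e -> exists2 d : R, 0 < d & forall t : R, 0 < t < d ->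
  `|f (p + t *: u + t *: v) - f (p + t *: u) - f (p + t *: v) + f p
    - t ^+ 2 * 'D_v ('D_u f) p| <= e * t ^+ 2.
Proof.
move=> df dk e e0; set k := 'D_u f.
(* All points in play lie within [t * N] of [p], and the summand 1 makes [N] positive. Two
   remainders at distance at most [t * N] explain the tolerance [e / (2 * N)] below. *)
pose N := `|u| + `|v| + 1; have N0 : 0 < N by rewrite ltr_wpDl ?addr_ge0.
have [_ /eqaddoP ko] := (diff_locallyP _ _).1 dk.
have e'0 : 0 < e / (2 * N) by rewrite divr_gt0 ?mulr_gt0.
have df0 : \forall h \near (0 : V), differentiable f (p + h).
  have := df; rewrite [X in X -> _](near_shift 0) /= subr0.
  by apply: filterS => h; rewrite /= addrC.
have /nbhs_ballP[d /= d0 Hd] :=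
  @filterI _ _ (nbhs_filter (0 : V)) _ _ df0 (ko _ e'0).
exists (d / N); first by rewrite divr_gt0.
have {}Hd h : `|h| < d -> differentiable f (p + h) /\
    `|k (p + h) - k p - 'd k p h| <= e / (2 * N) * `|h|.
  move=> hd; have [|? H] := Hd h; first by rewrite -ball_normE /= sub0r normrN.
  by split=> //; move: H; rewrite !fctE /= /shift /= opprD addrA [h + p]addrC.
move=> t /andP[t0 td].
have hu s : 0 <= s <= t -> `|s *: u| <= t * N.
  move=> /andP[s0 st]; rewrite normrZ ger0_norm// ler_pM//.
  by rewrite /N -addrA lerDl addr_ge0.
have huv s : 0 <= s <= t -> `|t *: v + s *: u| <= t * N.
  move=> /andP[s0 st]; apply: le_trans (ler_normD _ _) _.
  rewrite !normrZ (ger0_norm s0) gtr0_norm// /N mulrDr mulr1 mulrDr.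
  have : s * `|u| <= t * `|u| by rewrite ler_wpM2r.
  lra.
have tNd : t * N < d by rewrite -ltr_pdivlMr.
pose q := p + t *: v.
pose phi := (fun s : R => f (q + s *: u)) - (fun s : R => f (p + s *: u)).
pose dphi := fun s : R => k (q + s *: u) - k (p + s *: u).
have dphiP s : 0 <= s <= t -> is_derive s 1 phi (dphi s).
  move=> hs; apply: is_deriveB; apply: is_derive_line; apply: diff_derivable.
    by rewrite /q -addrA; apply: (Hd _ _).1; apply: le_lt_trans (huv s hs) tNd.
  by apply: (Hd _ _).1; apply: le_lt_trans (hu s hs) tNd.
have [| |xi xit] := @MVT R phi dphi 0 t t0.
- by move=> s /[!in_itv]/= /andP[/ltW s0 /ltW st]; apply: dphiP; rewrite s0.
- apply: derivable_within_continuous => s /[!in_itv]/= hs.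
  by have [] := dphiP s hs.
have {}xit : 0 <= xi <= t.
  by move: xit; rewrite in_itv/= => /andP[/ltW-> /ltW->].
have -> : phi t - phi 0 = f (p + t *: u + t *: v) - f (p + t *: u)
                          - f (p + t *: v) + f p.
  rewrite /phi !fctE /q !scale0r !addr0 (addrAC p (t *: v)); ring.
rewrite subr0 => ->.
have -> : 'D_v k p = 'd k p v by rewrite deriveE.
have [_ H1] := Hd _ (le_lt_trans (huv _ xit) tNd).
have [_ H2] := Hd _ (le_lt_trans (hu _ xit) tNd).
have -> : dphi xi * t - t ^+ 2 * 'd k p v =
  t * ((k (p + (t *: v + xi *: u)) - k p - 'd k p (t *: v + xi *: u))
     - (k (p + xi *: u) - k p - 'd k p (xi *: u))).
  have -> : 'd k p (t *: v + xi *: u) = t * 'd k p v + 'd k p (xi *: u).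
    by rewrite linearD linearZ.
  by rewrite /dphi /q -addrA; ring.
rewrite normrM gtr0_norm// expr2 mulrCA ler_pM2l//.
apply: le_trans (ler_normB _ _) _.
have := lerD H1 H2; move/le_trans; apply; rewrite -mulrDr.
have : `|t *: v + xi *: u| + `|xi *: u| <= 2 * (t * N).
  by have := lerD (huv _ xit) (hu _ xit); lra.
move=> /(ler_wpM2l (ltW e'0)) /le_trans; apply.
rewrite le_eqVlt; apply/orP; left; apply/eqP; field.
by rewrite gt_eqF.
Qed.

Lemma second_difference_gap (x y z w s A B e : R) :
  `|x - y - z + w - s * B| <= e / 2 * s ->
  `|x - z - y + w - s * A| <= e / 2 * s -> `|s * (A - B)| <= s * e.
Proof.
rewrite !ler_norml => /andP[a1 a2] /andP[b1 b2].
by rewrite mulrBr; apply/andP; split; lra.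
Qed.

(** The second difference is symmetric in [u] and [v], so t^2 times either mixed derivative
    approximates the same number. *)
Lemma schwarz (f : V -> R) (p u v : V) :
  (\forall x \near p, differentiable f x) ->
  differentiable ('D_u f) p -> differentiable ('D_v f) p ->
  'D_u ('D_v f) p = 'D_v ('D_u f) p.
Proof.
move=> df du dv; apply/eqP; rewrite -subr_eq0 -normr_eq0 eq_le normr_ge0 andbT.
apply/ler_addgt0Pr => e e0; rewrite add0r.
have e2 : 0 < e / 2 by rewrite divr_gt0.
have [d d0 Hd] := second_difference v df du e2.
have [d' d'0 Hd'] := second_difference u df dv e2.
pose t := Num.min d d' / 2.
have m0 : 0 < Num.min d d' by rewrite lt_min d0.
have t0 : 0 < t by rewrite divr_gt0.
have tm : t < Num.min d d' by rewrite /t; lra.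
move: (tm); rewrite lt_min => /andP[td td'].
have t2 : 0 < t ^+ 2 by rewrite exprn_gt0.
have h1 := Hd t; rewrite t0 td in h1; have {}h1 := h1 isT.
have h2 := Hd' t; rewrite t0 td' in h2; have {}h2 := h2 isT.
rewrite (addrAC p) in h2.
rewrite -(ler_pM2l t2) -[X in X * `|_|](gtr0_norm t2) -normrM.
exact: second_difference_gap h1 h2.
Qed.

End Schwarz.

Lemma schwarz_row (R : realType) (V : normedModType R) (m : nat)
    (f : V -> 'rV[R]_m) (p u v : V) :
  (\forall x \near p, differentiable f x) ->
  differentiable ('D_u f) p -> differentiable ('D_v f) p ->
  'D_u ('D_v f) p = 'D_v ('D_u f) p.
Proof.
move=> df du dv; apply/rowP => j.
have dc (h : V -> 'rV[R]_m) x : differentiable h x ->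
    differentiable (fun y => h y 0 j) x.
  by move=> dh; apply: differentiable_comp dh (differentiable_coord _ _ _).
have De (h : V -> 'rV[R]_m) x w : differentiable h x ->
    'D_w h x 0 j = 'D_w (fun y => h y 0 j) x.
  by move=> dh; rewrite derive_mx ?mxE//; exact: diff_derivable.
have nD w : \near p, ('D_w f) p 0 j = ('D_w (fun y => f y 0 j)) p.
  by apply: filterS df => x dfx; rewrite De.
apply: etrans (De _ _ u dv) _.
apply: etrans _ (esym (De _ _ v du)).
apply: etrans (near_eq_derive u (nD v)) _.
apply: etrans _ (esym (near_eq_derive v (nD u))).
apply: schwarz.
- by apply: filterS df => x; exact: dc.
- exact: near_eq_diff (nD u) (dc _ _ du).
- exact: near_eq_diff (nD v) (dc _ _ dv).
Qed.

(** * Hermitian vector spaces and skew torsion *)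

Record bilinear2 (R : realType) (U : lmodType R) (B : U -> U -> U) : Prop := {
  bilDl : forall u v w, B (u + v) w = B u w + B v w;
  bilDr : forall u v w, B u (v + w) = B u v + B u w;
  bilZl : forall a u v, B (a *: u) v = a *: B u v;
  bilZr : forall a u v, B u (a *: v) = a *: B u v }.

Section Bilinear2.
Context {R : realType} {U : lmodType R} {B : U -> U -> U} (bB : bilinear2 B).

Lemma bilNl u v : B (- u) v = - B u v.
Proof. by rewrite -scaleN1r (bilZl bB) scaleN1r. Qed.

Lemma bilNr u v : B u (- v) = - B u v.
Proof. by rewrite -scaleN1r (bilZr bB) scaleN1r. Qed.

Lemma bil0l u : B 0 u = 0.
Proof. by have := bilZl bB 0 0 u; rewrite !scale0r. Qed.

Lemma bil0r u : B u 0 = 0.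
Proof. by have := bilZr bB 0 u 0; rewrite !scale0r. Qed.

End Bilinear2.

Record hermitian_space (R : realType) (U : lmodType R) (g : U -> U -> R)
    (J : U -> U) : Prop := {
  hgDl : forall u v w, g (u + v) w = g u w + g v w;
  hgZl : forall a u v, g (a *: u) v = a * g u v;
  hgC : forall u v, g u v = g v u;
  hg_gt0 : forall u, u != 0 -> 0 < g u u;
  hJD : forall u v, J (u + v) = J u + J v;
  hJZ : forall a u, J (a *: u) = a *: J u;
  hJJ : forall u, J (J u) = - u;
  hgJ : forall u v, g (J u) (J v) = g u v }.

Section HermitianSpace.
Context {R : realType} {U : lmodType R} {g : U -> U -> R} {J : U -> U}.
Context (gJ : hermitian_space g J).

Lemma hgDr u v w : g u (v + w) = g u v + g u w.
Proof. by rewrite (hgC gJ) (hgDl gJ) (hgC gJ v) (hgC gJ w). Qed.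

Lemma hgZr a u v : g u (a *: v) = a * g u v.
Proof. by rewrite (hgC gJ) (hgZl gJ) (hgC gJ u). Qed.

Lemma hgNl u v : g (- u) v = - g u v.
Proof. by rewrite -scaleN1r (hgZl gJ) mulN1r. Qed.

Lemma hgNr u v : g u (- v) = - g u v.
Proof. by rewrite -scaleN1r hgZr mulN1r. Qed.

Lemma hg0l u : g 0 u = 0.
Proof. by have := hgZl gJ 0 0 u; rewrite scale0r mul0r. Qed.

Lemma hg0r u : g u 0 = 0.
Proof. by rewrite (hgC gJ) hg0l. Qed.

Lemma hJN u : J (- u) = - J u.
Proof. by rewrite -scaleN1r (hJZ gJ) scaleN1r. Qed.

Lemma hJ0 : J 0 = 0.
Proof. by have := hJZ gJ 0 0; rewrite !scale0r. Qed.

Lemma hg_inj u v : (forall w, g u w = g v w) -> u = v.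
Proof.
move=> uv; apply/eqP; rewrite -subr_eq0; apply/negPn/negP => /(hg_gt0 gJ).
by rewrite (hgDl gJ) hgNl uv subrr ltxx.
Qed.

Lemma hg_ge0 u : 0 <= g u u.
Proof.
by have [->|/(hg_gt0 gJ)/ltW//] := eqVneq u 0; rewrite hg0l.
Qed.

Lemma hg_eq0 u : g u u = 0 -> u = 0.
Proof.
by move=> u0; apply/eqP/negPn/negP => /(hg_gt0 gJ); rewrite u0 ltxx.
Qed.

Lemma hgJr u v : g u (J v) = - g (J u) v.
Proof. by rewrite -(hgJ gJ) (hJJ gJ) hgNr. Qed.

End HermitianSpace.

(* The algebraic properties of the Strominger torsion at a point: [g (T u v) w]
   is a 3-form of type (2,1) + (1,2). *)
Record skew_torsion (R : realType) (U : lmodType R) (g : U -> U -> R)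
    (J : U -> U) (T : U -> U -> U) : Prop := {
  stB : bilinear2 T;
  st_skew : forall u v, T v u = - T u v;
  st_skewr : forall u v w, g (T u w) v = - g (T u v) w;
  st_type : forall u v, T u v = T (J u) (J v) - J (T (J u) v) - J (T u (J v)) }.

(* The complex bilinear bracket of (1,0)-vectors given by the (2,1) part of the
   torsion, and the adjoint of [hol v]. *)
Definition hol (R : realType) (U : lmodType R) (J : U -> U)
    (T : U -> U -> U) u v := 2^-1 *: (T u v - T (J u) (J v)).
Definition adj (R : realType) (U : lmodType R) (J : U -> U)
    (T : U -> U -> U) v u := 2^-1 *: (T u v + J (T u (J v))).

Section Split.
Context {R : realType} {U : lmodType R} {g : U -> U -> R} {J : U -> U}.
Context (gJ : hermitian_space g J).

Context {T : U -> U -> U} (tT : skew_torsion g J T).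
Let bT := stB tT.

Let Dg := (hgDl gJ, hgDr gJ, hgNl gJ, hgNr gJ, hgZl gJ, hgZr gJ).
Let DJ := (hJD gJ, hJN gJ, hJZ gJ, hJJ gJ).
Let DT := (bilDl bT, bilDr bT, bilNl bT, bilNr bT, bilZl bT, bilZr bT).

Lemma hol_bilinear : bilinear2 (hol J T).
Proof.
by split=> *; apply: (hg_inj gJ) => z; rewrite /hol !(DJ, DT, Dg); lra.
Qed.

Lemma adj_bilinear : bilinear2 (adj J T).
Proof.
by split=> *; apply: (hg_inj gJ) => z; rewrite /adj !(DJ, DT, Dg); lra.
Qed.

Lemma hol_skew u v : hol J T v u = - hol J T u v.
Proof.
rewrite /hol (st_skew tT) (st_skew tT (J u)).
by apply: (hg_inj gJ) => z; rewrite !Dg; lra.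
Qed.

Let type z u v := congr1 (fun x => g x z) (st_type tT u v).

Lemma hol_Jl u v : hol J T (J u) v = J (hol J T u v).
Proof.
apply: (hg_inj gJ) => z; rewrite /hol.
by move: (type z (J u) v); rewrite /= !(DJ, DT, Dg); lra.
Qed.

Lemma hol_Jr u v : hol J T u (J v) = J (hol J T u v).
Proof. by rewrite hol_skew hol_Jl [in RHS]hol_skew !DJ. Qed.

Lemma adj_Jl u v : adj J T (J u) v = - J (adj J T u v).
Proof.
by apply: (hg_inj gJ) => z; rewrite /adj !(DJ, DT, Dg); lra.
Qed.

Lemma adj_Jr u v : adj J T u (J v) = J (adj J T u v).
Proof.
apply: (hg_inj gJ) => z; rewrite /adj.
by move: (type z v (J u)); rewrite /= !(DJ, DT, Dg); lra.
Qed.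

Lemma st_rot x y z : g (T x y) z = g (T y z) x.
Proof. by rewrite (st_skew tT y x) !Dg (st_skewr tT y z x) opprK. Qed.

Lemma adj_adjoint u v w : g (hol J T u v) w = g v (adj J T u w).
Proof.
rewrite /hol /adj !Dg (hgJr gJ) (hgC gJ v) (hgC gJ (J v)).
by rewrite (st_rot w u) (st_rot w (J u)).
Qed.

(** [st_type] says exactly that [T] has no part J-antilinear in both arguments. Of the three
    remaining parts, [hol] is linear in both, and the two [adj] terms are linear in one argument and
    antilinear in the other. *)
Lemma split_torsion u v : T u v = hol J T u v + adj J T v u - adj J T u v.
Proof.
rewrite /hol /adj (st_skew tT u v) (st_skew tT (J u) v).
apply: (hg_inj gJ) => z.
by move: (type z u v); rewrite /= !(DJ, DT, Dg); lra.
Qed.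

End Split.

(** * The bracket of type (2,1) and the (2,2) part of the Jacobiator *)

(** The Jacobi identity for [L] is not a field: it is derived later, from K = -(1/3) Jac. *)
Record herm_bracket (R : realType) (U : lmodType R) (g : U -> U -> R)
    (J : U -> U) (L N : U -> U -> U) : Prop := {
  hbL : bilinear2 L;
  hbN : bilinear2 N;
  hb_skew : forall u v, L v u = - L u v;
  hbLJl : forall u v, L (J u) v = J (L u v);
  hbLJr : forall u v, L u (J v) = J (L u v);
  hbNJl : forall u v, N (J u) v = - J (N u v);
  hbNJr : forall u v, N u (J v) = J (N u v);
  hb_adj : forall u v w, g (L u v) w = g v (N u w) }.

Lemma split_herm_bracket (R : realType) (U : lmodType R) (g : U -> U -> R)
    (J : U -> U) (T : U -> U -> U) :
  hermitian_space g J -> skew_torsion g J T ->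
  herm_bracket g J (hol J T) (adj J T).
Proof.
move=> gJ tT; split.
- exact (hol_bilinear gJ tT).
- exact (adj_bilinear gJ tT).
- exact (hol_skew gJ tT).
- exact (hol_Jl gJ tT).
- exact (hol_Jr gJ tT).
- exact (adj_Jl gJ tT).
- exact (adj_Jr gJ tT).
- exact (adj_adjoint gJ tT).
Qed.

Definition jac (U : zmodType) (T : U -> U -> U) x y z :=
  T (T x y) z + T (T y z) x + T (T z x) y.

(* The (2,2) part of the 4-form [g (jac T x y z) w], as an endomorphism valued
   form; [N u] stands for the adjoint of [L u].  Locking stops unification from
   exposing the sum. *)
Definition phi (U : zmodType) (L N : U -> U -> U) i j m := locked
  (L (N m i) j + L i (N m j) - N m (L i j) + N (N i m) j - N (N j m) i).

Lemma phiE (U : zmodType) (L N : U -> U -> U) i j m : phi L N i j m =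
  L (N m i) j + L i (N m j) - N m (L i j) + N (N i m) j - N (N j m) i.
Proof. by rewrite /phi -lock. Qed.

Section Phi.
Context {R : realType} {U : lmodType R} {g : U -> U -> R} {J : U -> U}.
Context (gJ : hermitian_space g J).
Context {L N : U -> U -> U} (hb : herm_bracket g J L N).
Let bL := hbL hb.
Let bN := hbN hb.

Let Dg := (hgDl gJ, hgDr gJ, hgNl gJ, hgNr gJ, hgZl gJ, hgZr gJ).
Let DJ := (hJD gJ, hJN gJ, hJZ gJ, hJJ gJ).
Let DL := (bilDl bL, bilDr bL, bilNl bL, bilNr bL, bilZl bL, bilZr bL).
Let DN := (bilDl bN, bilDr bN, bilNl bN, bilNr bN, bilZl bN, bilZr bN).
Let LJ := (hbLJl hb, hbLJr hb, hbNJl hb, hbNJr hb).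

Local Notation phi := (phi L N).

Lemma phiD1 i i' j m : phi (i + i') j m = phi i j m + phi i' j m.
Proof. by apply: (hg_inj gJ) => z; rewrite !phiE !(DL, DN, Dg); lra. Qed.

Lemma phiD2 i j j' m : phi i (j + j') m = phi i j m + phi i j' m.
Proof. by apply: (hg_inj gJ) => z; rewrite !phiE !(DL, DN, Dg); lra. Qed.

Lemma phiD3 i j m m' : phi i j (m + m') = phi i j m + phi i j m'.
Proof. by apply: (hg_inj gJ) => z; rewrite !phiE !(DL, DN, Dg); lra. Qed.

Lemma phiZ1 a i j m : phi (a *: i) j m = a *: phi i j m.
Proof. by apply: (hg_inj gJ) => z; rewrite !phiE !(DL, DN, Dg); lra. Qed.

Lemma phiZ2 a i j m : phi i (a *: j) m = a *: phi i j m.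
Proof. by apply: (hg_inj gJ) => z; rewrite !phiE !(DL, DN, Dg); lra. Qed.

Lemma phiZ3 a i j m : phi i j (a *: m) = a *: phi i j m.
Proof. by apply: (hg_inj gJ) => z; rewrite !phiE !(DL, DN, Dg); lra. Qed.

Lemma phiN1 i j m : phi (- i) j m = - phi i j m.
Proof. by rewrite -scaleN1r phiZ1 scaleN1r. Qed.

Lemma phiN2 i j m : phi i (- j) m = - phi i j m.
Proof. by rewrite -scaleN1r phiZ2 scaleN1r. Qed.

Lemma phiN3 i j m : phi i j (- m) = - phi i j m.
Proof. by rewrite -scaleN1r phiZ3 scaleN1r. Qed.

Lemma phi_skew i j m : phi j i m = - phi i j m.
Proof.
rewrite !phiE (hb_skew hb i (N m j)) (hb_skew hb (N m i) j) (hb_skew hb i j).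
by apply: (hg_inj gJ) => z; rewrite !(DL, DN, Dg); lra.
Qed.

Lemma phiJ1 i j m : phi (J i) j m = J (phi i j m).
Proof.
by apply: (hg_inj gJ) => z; rewrite !phiE !(LJ, DL, DN, DJ, Dg); lra.
Qed.

Lemma phiJ2 i j m : phi i (J j) m = J (phi i j m).
Proof.
by apply: (hg_inj gJ) => z; rewrite !phiE !(LJ, DL, DN, DJ, Dg); lra.
Qed.

Lemma phiJ3 i j m : phi i j (J m) = - J (phi i j m).
Proof.
by apply: (hg_inj gJ) => z; rewrite !phiE !(LJ, DL, DN, DJ, Dg); lra.
Qed.

Lemma hb_adj_sym u v w : g (N u v) w = g v (L u w).
Proof. by rewrite (hgC gJ) -(hb_adj hb) (hgC gJ). Qed.

(** Written with inner products of single brackets only, the form shows the symmetries that the next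
    two lemmas read off. *)
Lemma phi_formE i j k m : g (phi i j m) k =
  - g (L i j) (L m k) - g (N m i) (N j k) + g (N m j) (N i k)
  - g (N k j) (N i m) + g (N k i) (N j m).
Proof.
rewrite !phiE (hb_skew hb j) !Dg -!(hb_adj hb i) (hb_adj_sym m).
have H a b : g (N (N a m) b) k = - g (N k b) (N a m).
  by rewrite !hb_adj_sym (hb_skew hb k) Dg.
by rewrite !H !(hb_adj hb); lra.
Qed.

Lemma phi_skew_adj i j m k : g (phi i j m) k = - g (phi i j k) m.
Proof.
rewrite !phi_formE (hb_skew hb m k) !Dg.
rewrite (hgC gJ (N k i)) (hgC gJ (N k j)) (hgC gJ (N m i)) (hgC gJ (N m j)).
lra.
Qed.

(** This is self-adjointness on bivectors. The trace argument uses it to move a linear map from an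
    argument of [phi] to its value. *)
Lemma phi_pair i j m k : g (phi i j m) k = g (phi k m j) i.
Proof.
rewrite !phi_formE (hb_skew hb i j) (hgC gJ (L k m)) (hb_skew hb m k) !Dg.
rewrite (hgC gJ (N j k)) (hgC gJ (N i k)) (hgC gJ (N i m)) (hgC gJ (N j m)).
lra.
Qed.

End Phi.

(** * Type decomposition of K = -(1/3) Jac *)

Section DerivedTorsion.
Context {R : realType} {U : lmodType R} {g : U -> U -> R} {J : U -> U}.
Context (gJ : hermitian_space g J).
Context {T : U -> U -> U} (tT : skew_torsion g J T).
Context {K : U -> U -> U -> U} (tK : forall a, skew_torsion g J (K a)).
Hypothesis KE : forall a u v, K a u v = - 3^-1 *: jac T a u v.

Context {L N : U -> U -> U} (hb : herm_bracket g J L N).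
Hypothesis TE : forall u v, T u v = L u v + N v u - N u v.

Let Dg := (hgDl gJ, hgDr gJ, hgNl gJ, hgNr gJ, hgZl gJ, hgZr gJ).
Let DJ := (hJD gJ, hJN gJ, hJZ gJ, hJJ gJ).
Let bL := hbL hb.
Let bN := hbN hb.
Let bT := stB tT.
Let DT := (bilDl bT, bilDr bT, bilNl bT, bilNr bT, bilZl bT, bilZr bT).
Let DL := (bilDl bL, bilDr bL, bilNl bL, bilNr bL, bilZl bL, bilZr bL).
Let DN := (bilDl bN, bilDr bN, bilNl bN, bilNr bN, bilZl bN, bilZr bN).
Let LJ := (hbLJl hb, hbLJr hb, hbNJl hb, hbNJr hb).

Lemma derived_swap a u v : K u a v = - K a u v.
Proof.
rewrite !KE /jac (st_skew tT a u) (st_skew tT u v) (st_skew tT v a).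
by apply: (hg_inj gJ) => z; rewrite !(DT, Dg); lra.
Qed.

Lemma derived_cycle a u v w : g (K w a u) v = - g (K a u v) w.
Proof. by rewrite derived_swap Dg (st_rot gJ (tK a)). Qed.

Lemma derived_type a u v w : g (K a u v) w =
  g (K a (J u) (J v)) w + g (K a (J u) v) (J w) + g (K a u (J v)) (J w).
Proof. by rewrite [in LHS](st_type (tK a)) !Dg !(hgJr gJ). Qed.

(** By [derived_swap], [K] is a 4-form. All its contractions have type (2,1) + (1,2), so it has type
    (2,2); the two linear slots [u] and [v] then leave [m] antilinear. *)
Lemma derived_antiholomorphic m u v :
  hol J (K (J m)) u v = - J (hol J (K m) u v).
Proof.
apply: (hg_inj gJ) => w; rewrite /hol Dg -(hgJr gJ) !Dg.
move: (derived_type (J m) u v w) (derived_type (J w) m u v).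
by rewrite !(derived_cycle _ _ _ (J w)); lra.
Qed.

Let X m u v := - (2^-1 *: (jac T m u v - jac T m (J u) (J v))).

Let X_hol m u v : 3 *: hol J (K m) u v = X m u v.
Proof.
by apply: (hg_inj gJ) => w; rewrite /X /hol !KE !Dg; lra.
Qed.

Let X_type m u v : X (J m) u v = - J (X m u v) /\ X m (J u) v = J (X m u v).
Proof.
rewrite -!X_hol derived_antiholomorphic (hol_Jl gJ (tK m)).
by rewrite !(hJZ gJ) scalerN.
Qed.

(** The adjoint of the Jacobi defect: [g (B x y z) w] equals [g z (L x (L y w) - L y (L x w) - L (L
    x y) w)]. *)
Let B x y z := N y (N x z) - N x (N y z) - N (L x y) z.

(** The three kinds of terms have different types: [jac L] is J-linear in every slot, [phi] is
    antilinear in its last slot only, and [B] in its first two. *)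
Let jacE x y z : jac T x y z = jac L x y z
  - (phi L N x y z + phi L N y z x + phi L N z x y)
  + (B x y z + B y z x + B z x y).
Proof.
rewrite /jac !phiE /B !TE (hb_skew hb (N z y)) (hb_skew hb (N x z)).
rewrite (hb_skew hb (N y x)).
by apply: (hg_inj gJ) => w; rewrite !(DL, DN, Dg); lra.
Qed.

Let BJ x y z : [/\ B (J x) y z = - J (B x y z), B x (J y) z = - J (B x y z)
  & B x y (J z) = J (B x y z)].
Proof.
by split; apply: (hg_inj gJ) => w; rewrite /B !(LJ, DL, DN, DJ, Dg); lra.
Qed.

Let BJ1 x y z : B (J x) y z = - J (B x y z). Proof. by case: (BJ x y z). Qed.
Let BJ2 x y z : B x (J y) z = - J (B x y z). Proof. by case: (BJ x y z). Qed.
Let BJ3 x y z : B x y (J z) = J (B x y z). Proof. by case: (BJ x y z). Qed.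

Let CJ x y z : [/\ jac L (J x) y z = J (jac L x y z),
  jac L x (J y) z = J (jac L x y z) & jac L x y (J z) = J (jac L x y z)].
Proof.
by split; apply: (hg_inj gJ) => w; rewrite /jac !(LJ, DL, DJ, Dg); lra.
Qed.

Let CJ1 x y z : jac L (J x) y z = J (jac L x y z).
Proof. by case: (CJ x y z). Qed.
Let CJ2 x y z : jac L x (J y) z = J (jac L x y z).
Proof. by case: (CJ x y z). Qed.
Let CJ3 x y z : jac L x y (J z) = J (jac L x y z).
Proof. by case: (CJ x y z). Qed.

Let XE m u v : X m u v = phi L N u v m - jac L m u v - B u v m.
Proof.
apply: (hg_inj gJ) => w; rewrite /X !jacE.
rewrite !(BJ1, BJ2, BJ3, CJ1, CJ2, CJ3, phiJ1 gJ hb, phiJ2 gJ hb, phiJ3 gJ hb,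
  DJ, Dg); lra.
Qed.

Let XJ1 m u v z := congr1 (fun x => g x z) (X_type m u v).1.
Let XJ2 m u v z := congr1 (fun x => g x z) (X_type m u v).2.

(** In [XE], [X] and [phi] are antilinear in [m] while the other two terms are linear in it, so
    these cancel each other. Both [X] and [jac L] are linear in [u] but [B] is antilinear in it, so
    each of the two vanishes. *)
Let X_vanish m u v : jac L m u v = 0 /\ B u v m = 0.
Proof.
split; apply: (hg_inj gJ) => z; rewrite (hg0l gJ);
  move: (XJ1 (J m) u v z) (XJ2 m (J u) v z); rewrite !XE /=;
  rewrite !(BJ1, BJ2, BJ3, CJ1, CJ2, CJ3, phiJ1 gJ hb, phiJ2 gJ hb,
    phiJ3 gJ hb, DJ, Dg); lra.
Qed.

Lemma hol_derived m u v : 3 *: hol J (K m) u v = phi L N u v m.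
Proof.
have [j0 b0] := X_vanish m u v.
by rewrite X_hol XE j0 b0 !subr0.
Qed.

Lemma jac_hol x y z : jac L x y z = 0.
Proof. by have [] := X_vanish x y z. Qed.

End DerivedTorsion.

(** * Consequences of the Ricci identity *)

(* The tensor [3 D_a (phi L N)], when [3 D_a L] and [3 D_a N] are [phi L N] and
   [M a]. *)
Definition dphi (U : zmodType) (L N : U -> U -> U) (M : U -> U -> U -> U)
    a i j m := let phi := phi L N in locked (
  (phi (N m i) j a + L (M a m i) j) + (phi i (N m j) a + L i (M a m j))
  - (M a m (L i j) + N m (phi i j a))
  + (M a (N i m) j + N (M a i m) j) - (M a (N j m) i + N (M a j m) i)).

(* The action of [ad k] on the bivector [phi l m], seen as an antilinear skew
   operator; [del] is the adjoint action. *)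
Definition rho (U : zmodType) (L N : U -> U -> U) k l m x :=
  locked (L k (phi L N l m x) + phi L N l m (N k x)).

Lemma rhoE (U : zmodType) (L N : U -> U -> U) k l m x :
  rho L N k l m x = L k (phi L N l m x) + phi L N l m (N k x).
Proof. by rewrite /rho -lock. Qed.

Definition del (U : zmodType) (L N : U -> U -> U) a l m x :=
  locked (N a (phi L N l m x) + phi L N l m (L a x)).

Lemma delE (U : zmodType) (L N : U -> U -> U) a l m x :
  del L N a l m x = N a (phi L N l m x) + phi L N l m (L a x).
Proof. by rewrite /del -lock. Qed.

Section Brackets.
Context {R : realType} {U : lmodType R} {g : U -> U -> R} {J : U -> U}.
Context (gJ : hermitian_space g J).
Context {L N : U -> U -> U} (hb : herm_bracket g J L N).
Local Notation phi := (phi L N).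
Local Notation rho := (rho L N).
Local Notation del := (del L N).
Context {M : U -> U -> U -> U}.
Hypothesis M_adj : forall u v m w, g (phi u v m) w = g v (M m u w).

Let bL := hbL hb.
Let bN := hbN hb.
Let Dg := (hgDl gJ, hgDr gJ, hgNl gJ, hgNr gJ, hgZl gJ, hgZr gJ).
Let DJ := (hJD gJ, hJN gJ, hJZ gJ, hJJ gJ).
Let DL := (bilDl bL, bilDr bL, bilNl bL, bilNr bL, bilZl bL, bilZr bL).
Let DN := (bilDl bN, bilDr bN, bilNl bN, bilNr bN, bilZl bN, bilZr bN).
Let LJ := (hbLJl hb, hbLJr hb, hbNJl hb, hbNJr hb).
Let Dp := (phiN1 gJ hb, phiN2 gJ hb, phiN3 gJ hb, phiD1 gJ hb, phiD2 gJ hb,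
  phiD3 gJ hb, phiZ1 gJ hb, phiZ2 gJ hb, phiZ3 gJ hb).
Let pJ := (phiJ1 gJ hb, phiJ2 gJ hb, phiJ3 gJ hb).

Let M_sym v m u w : g (M m u w) v = g (phi u v m) w.
Proof. by rewrite M_adj (hgC gJ). Qed.

Let gJl x y : g (J x) y = - g x (J y).
Proof. by rewrite (hgJr gJ) opprK. Qed.

Lemma M_J1 m u w : M (J m) u w = J (M m u w).
Proof.
by apply: (hg_inj gJ) => v; rewrite M_sym pJ Dg [RHS]gJl M_sym pJ.
Qed.

Lemma M_J2 m u w : M m (J u) w = - J (M m u w).
Proof.
by apply: (hg_inj gJ) => v; rewrite M_sym pJ Dg [in RHS]gJl opprK M_sym pJ.
Qed.

Lemma M_J3 m u w : M m u (J w) = J (M m u w).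
Proof.
by apply: (hg_inj gJ) => v; rewrite M_sym [RHS]gJl M_sym pJ gJl opprK.
Qed.

Lemma M_N1 m u w : M (- m) u w = - M m u w.
Proof. by apply: (hg_inj gJ) => v; rewrite Dg !M_sym !Dp Dg. Qed.

Lemma M_N2 m u w : M m (- u) w = - M m u w.
Proof. by apply: (hg_inj gJ) => v; rewrite Dg !M_sym !Dp Dg. Qed.

Lemma M_N3 m u w : M m u (- w) = - M m u w.
Proof. by apply: (hg_inj gJ) => v; rewrite Dg !M_sym Dg. Qed.

Let MJ := (M_J1, M_J2, M_J3, M_N1, M_N2, M_N3).

(* The J-antilinear part of [dphi] in its first argument. *)
Definition aphi a i j m := locked
  (phi (N m i) j a + phi i (N m j) a - N m (phi i j a)
  + N (M a i m) j - N (M a j m) i).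

Lemma dphi_anti a i j m :
  dphi L N M a i j m + J (dphi L N M (J a) i j m) = 2 *: aphi a i j m.
Proof.
by apply: (hg_inj gJ) => w; rewrite /dphi /aphi -!lock /=;
  rewrite !(pJ, Dp, MJ, LJ, DL, DN, DJ, Dg); lra.
Qed.

Lemma dphi_antim a i j m :
  dphi L N M a i j (J m) = - J (dphi L N M a i j m).
Proof.
by apply: (hg_inj gJ) => w; rewrite /dphi -!lock /=;
  rewrite !(pJ, Dp, MJ, LJ, DL, DN, DJ, Dg); lra.
Qed.

Let ps := phi_skew gJ hb.
Let pa := phi_skew_adj gJ hb.
Let pp := phi_pair gJ hb.

Lemma rho_skew k l m x : rho k m l x = - rho k l m x.
Proof.
rewrite !rhoE (ps l m) (ps l m (N k x)).
by apply: (hg_inj gJ) => w; rewrite !(DL, Dg); lra.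
Qed.

(** Adjunction rewrites the antilinear derivative of [phi] in terms of [rho] and [phi (L _ _)].
    These are also the unknowns of the differentiated Jacobi identity, so the two systems can be
    solved together. *)
Lemma aphi_pair l i j m k : g (aphi l i j m) k =
  g (rho m k l j - rho k m l j - phi (L m k) l j) i.
Proof.
rewrite !rhoE /aphi -lock !Dg.
have NL u v w : g (N u v) w = g v (L u w) := hb_adj_sym gJ hb u v w.
have -> : g (phi (N m i) j l) k = g (L m (phi k l j)) i.
  by rewrite pp (hb_adj hb).
have -> : g (phi i (N m j) l) k = g (phi k l (N m j)) i by rewrite pp.
have -> : g (N m (phi i j l)) k = g (phi (L m k) l j) i by rewrite NL pp.
have H y a b : g (N (M l a m) b) y = - g (phi m l (N y b)) a.
  by rewrite NL (hb_skew hb y) Dg (hgC gJ b) (hb_adj hb) M_sym pp.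
rewrite !H [g (phi m l (N k i)) j]pa (hgC gJ _ (N k i)) NL (hgC gJ i).
lra.
Qed.

(** [Q l m] is a multiple of the curvature acting on [L]. In [Q l m - Q (J l) (J m)] the derivatives
    pair up into antilinear parts by [dphi_anti], and T(l, m) - T(Jl, Jm) = 2 L(l, m). *)
Lemma ricci_aphi (T : U -> U -> U) :
  (forall u v, T u v = L u v + N v u - N u v) ->
  (forall l m i j,
    let Q l m := dphi L N M l i j m - dphi L N M m i j l + 3 *: phi i j (T l m)
    in Q (J l) (J m) = Q l m) ->
  forall l m i j, aphi l i j m - aphi m i j l + 3 *: phi i j (L l m) = 0.
Proof.
move=> TE ricci l m i j; apply: (hg_inj gJ) => w; rewrite (hg0l gJ).
have := congr1 (fun x => g x w) (ricci l m i j); rewrite /= !dphi_antim !TE.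
have a1 := congr1 (fun x => g x w) (dphi_anti l i j m).
have a2 := congr1 (fun x => g x w) (dphi_anti m i j l).
move: a1 a2; rewrite /= !(LJ, DJ, Dp, Dg, pJ); lra.
Qed.

Hypothesis ricci : forall l m i j,
  aphi l i j m - aphi m i j l + 3 *: phi i j (L l m) = 0.
Hypothesis cocycle : forall i j k m,
  phi (L i j) k m + L (phi i j m) k + (phi (L j k) i m + L (phi j k m) i)
  + (phi (L k i) j m + L (phi k i m) j) = 0.

Let lb_skew := hb_skew hb.

Let ricci_rho k l m x :
  rho m k l x - rho k m l x - phi (L m k) l x
  - (rho l k m x - rho k l m x - phi (L l k) m x) + 3 *: phi k (L l m) x = 0.
Proof.
apply: (hg_inj gJ) => i; rewrite (hg0l gJ).
have := congr1 (fun y => g y k) (ricci l m i x).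
by rewrite /= (hg0l gJ) !Dg !aphi_pair !Dg (pp i x); lra.
Qed.

Let cocycle_rho i j k x :
  2 *: (phi (L i j) k x + phi (L j k) i x + phi (L k i) j x)
  = rho k i j x + rho i j k x + rho j k i x.
Proof.
apply: (hg_inj gJ) => w.
have := congr1 (fun y => g y w) (cocycle i j k x).
have := congr1 (fun y => g y x) (cocycle i j k w).
have H a b c : g (L (phi a b w) c) x = g (phi a b (N c x)) w.
  by rewrite (lb_skew c) Dg (hb_adj hb) pa opprK.
rewrite /= !(hg0l gJ) !Dg !H !rhoE !(lb_skew _ (phi _ _ x)) !Dg.
rewrite (pa (L i j) k w) (pa (L j k) i w) (pa (L k i) j w); lra.
Qed.

(** Let P be this cyclic sum and S the cyclic sum of [rho k l m x]. The differentiated Jacobi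
    identity gives S = -2 P and the three Ricci relations add up to 4 S + 5 P = 0, whence P = 0. *)
Lemma phi_cyclic k l m x :
  phi k (L l m) x + phi l (L m k) x + phi m (L k l) x = 0.
Proof.
apply: (hg_inj gJ) => w; rewrite (hg0l gJ).
have c := congr1 (fun y => g y w) (cocycle_rho k l m x).
have r1 := congr1 (fun y => g y w) (ricci_rho k l m x).
have r2 := congr1 (fun y => g y w) (ricci_rho l m k x).
have r3 := congr1 (fun y => g y w) (ricci_rho m k l x).
move: c r1 r2 r3; rewrite /= !Dg (hg0l gJ).
rewrite (lb_skew k m) (lb_skew l k) (lb_skew m l) !Dp.
rewrite !(ps _ (L _ _)).
rewrite (rho_skew k l m) (rho_skew l m k) (rho_skew m k l) !Dg.
lra.
Qed.

(** With S = P = 0, a single Ricci relation reduces to this equation. *)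
Lemma rho_eq k l m x : rho k l m x = - 2 *: phi k (L l m) x.
Proof.
apply: (hg_inj gJ) => w.
have c := congr1 (fun y => g y w) (cocycle_rho k l m x).
have r1 := congr1 (fun y => g y w) (ricci_rho k l m x).
have r2 := congr1 (fun y => g y w) (ricci_rho l m k x).
have r3 := congr1 (fun y => g y w) (ricci_rho m k l x).
move: c r1 r2 r3; rewrite /= !Dg (hg0l gJ).
rewrite (lb_skew k m) (lb_skew l k) (lb_skew m l) !Dp.
rewrite !(ps _ (L _ _)).
rewrite (rho_skew k l m) (rho_skew l m k) (rho_skew m k l) !Dg.
lra.
Qed.

(** [phi_cyclic] turns [rho_eq] into the form ad_k phi = -2 phi ad_k, in which [L k] acts on the
    bivector as a derivation. *)
Lemma rho_eq_derivation k l m x :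
  rho k l m x + 2 *: (phi (L k l) m x + phi l (L k m) x) = 0.
Proof.
apply: (hg_inj gJ) => w; rewrite rho_eq (hg0l gJ).
have := congr1 (fun y => g y w) (phi_cyclic k l m x).
rewrite (lb_skew k m) (ps m (L k l)) !Dp /= (hg0l gJ) !Dg; lra.
Qed.

(** This determines the antilinear part of the derivative of [phi] algebraically; the linear part
    stays unknown. *)
Lemma aphi_eq a i j m : aphi a i j m = - 3 *: del a i j m.
Proof.
apply: (hg_inj gJ) => k; rewrite aphi_pair !rho_eq !Dg.
rewrite delE !Dg (hb_adj_sym gJ hb) (pp i j m) (pp i j (L a m)).
have := congr1 (fun y => g y i) (phi_cyclic k m a j).
rewrite (lb_skew a m) (lb_skew k m) (lb_skew a k) !Dp !(ps _ (L _ _)).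
rewrite /= (hg0l gJ) !Dg; lra.
Qed.

Lemma dphi_J a i j m :
  dphi L N M (J a) i j m = J (dphi L N M a i j m + 6 *: del a i j m).
Proof.
have := congr1 J (dphi_anti a i j m); rewrite aphi_eq => e.
apply: (hg_inj gJ) => w; have := congr1 (fun y => g y w) e.
by rewrite /= !(DJ, Dg); lra.
Qed.

(** The hypothesis is the derivative of [rho_eq_derivation] in direction [b]. Its terms quadratic in
    [phi] are antilinear in [b], so the antilinear part keeps them and replaces [dphi] by -3 [del].
    The [del] terms at [L k l] and [L k m] are eliminated by [rho_eq_derivation] itself, once under
    [N a] and once at [L a x]. *)
Lemma commutator_rho a k l m x :
  (forall b, phi k (phi l m x) b + L k (dphi L N M b l m x)
    + dphi L N M b l m (N k x) + phi l m (M b k x)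
    + 2 *: (dphi L N M b (L k l) m x + phi (phi k l b) m x
           + dphi L N M b l (L k m) x + phi l (phi k m b) x) = 0) ->
  phi k (phi l m x) a + phi l m (M a k x)
    + 2 *: (phi (phi k l a) m x + phi l (phi k m a) x) =
  3 *: (L k (del a l m x) + del a l m (N k x)
       - N a (rho k l m x) - rho k l m (L a x)).
Proof.
move=> der; apply: (hg_inj gJ) => w.
have c1 := congr1 (fun y => g y w) (der a).
have c2 := congr1 (fun y => g (J y) w) (der (J a)).
have d1 := congr1 (fun y => g (N a y) w) (rho_eq_derivation k l m x).
have d2 := congr1 (fun y => g y w) (rho_eq_derivation k l m (L a x)).
move: c1 c2 d1 d2.
rewrite /= !dphi_J !(delE _ _ a (L k l)) !(delE _ _ a l (L k m)) (bil0r bN).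
rewrite !(hJ0 gJ) !(hg0l gJ) !(pJ, MJ, LJ, DL, DN, DJ, Dp, Dg).
lra.
Qed.

End Brackets.

(** * The trace argument *)

Section Traces.
Context {R : realType} {U : lmodType R} {g : U -> U -> R} {J : U -> U}.
Context (gJ : hermitian_space g J).
Context {d : nat} {e : 'I_d -> U}.
Hypothesis frame : forall u, u = \sum_i g u (e i) *: e i.

Definition lmap (f : U -> U) :=
  (forall u v, f (u + v) = f u + f v) /\ (forall a u, f (a *: u) = a *: f u).

Lemma lmap_frame f u : lmap f -> f u = \sum_i g u (e i) *: f (e i).
Proof.
move=> [fD fZ]; rewrite {1}(frame u).
have f0 : f 0 = 0 by have := fZ 0 0; rewrite !scale0r.
by rewrite (big_morph f fD f0); apply: eq_bigr => i _; rewrite fZ.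
Qed.

Lemma hg_suml I (r : seq I) (F : I -> U) v :
  g (\sum_(i <- r) F i) v = \sum_(i <- r) g (F i) v.
Proof.
exact: (big_morph (g^~ v) (fun a b => hgDl gJ a b v) (hg0l gJ v)).
Qed.

Lemma hg_sumr I (r : seq I) (F : I -> U) v :
  g v (\sum_(i <- r) F i) = \sum_(i <- r) g v (F i).
Proof. exact: (big_morph (g v) (hgDr gJ v) (hg0r gJ v)). Qed.

Lemma parseval u v : g u v = \sum_i g u (e i) * g v (e i).
Proof.
rewrite {1}(frame u) hg_suml; apply: eq_bigr => i _.
by rewrite (hgZl gJ) (hgC gJ v).
Qed.

Lemma lmap_diag f u : lmap f ->
  \sum_i g u (f (e i)) * g u (e i) = g (f u) u.
Proof.
move=> lf; rewrite (lmap_frame u lf) hg_suml; apply: eq_bigr => i _.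
by rewrite (hgZl gJ) mulrC (hgC gJ u (f _)).
Qed.

(** Cyclicity of the trace: tr(P^* X B) = tr(B P^* X), where B P^* is the adjoint of P A. *)
Lemma trace_adjoint (A B X P : U -> U) : lmap X -> lmap P ->
  (forall u v, g (A u) v = g u (B v)) ->
  \sum_i g (X (B (e i))) (P (e i)) = \sum_i g (X (e i)) (P (A (e i))).
Proof.
move=> lX lP AB.
under eq_bigr do rewrite (lmap_frame (B _) lX) hg_suml.
under [RHS]eq_bigr do rewrite (lmap_frame (A _) lP) hg_sumr.
rewrite exchange_big; apply: eq_bigr => i _; apply: eq_bigr => j _ /=.
by rewrite (hgZl gJ) (hgZr gJ) AB (hgC gJ (e i)).
Qed.

Lemma sum_sq_eq0 (F : 'I_d -> U) :
  \sum_i g (F i) (F i) = 0 -> forall i, F i = 0.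
Proof.
move=> F0 i; apply: (hg_eq0 gJ).
by apply: (psumr_eq0P _ F0) => // j _; exact: hg_ge0 gJ _.
Qed.

Lemma lmap_eq0 f : lmap f -> (forall i, f (e i) = 0) -> forall u, f u = 0.
Proof.
by move=> lf f0 u; rewrite (lmap_frame u lf) big1// => i _; rewrite f0 scaler0.
Qed.

Lemma sum_reverse4 (f : 'I_d -> 'I_d -> 'I_d -> 'I_d -> R) :
  \sum_i \sum_j \sum_k \sum_l f i j k l = \sum_l \sum_k \sum_j \sum_i f i j k l.
Proof.
under eq_bigr => i _.
  under eq_bigr do rewrite exchange_big.
  rewrite exchange_big.
  over.
rewrite exchange_big; apply: eq_bigr => l _ /=.
under eq_bigr do rewrite exchange_big.
rewrite exchange_big; apply: eq_bigr => k _ /=.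
by rewrite exchange_big.
Qed.

Context {L N : U -> U -> U} (hb : herm_bracket g J L N).
Local Notation phi := (phi L N).
Local Notation rho := (rho L N).
Local Notation del := (del L N).
Context {M : U -> U -> U -> U}.
Hypothesis M_adj : forall u v m w, g (phi u v m) w = g v (M m u w).

Let bL := hbL hb.
Let bN := hbN hb.
Let Dg := (hgDl gJ, hgDr gJ, hgNl gJ, hgNr gJ, hgZl gJ, hgZr gJ).
Let Dp := (phiN1 gJ hb, phiN2 gJ hb, phiN3 gJ hb, phiD1 gJ hb, phiD2 gJ hb,
  phiD3 gJ hb, phiZ1 gJ hb, phiZ2 gJ hb, phiZ3 gJ hb).
Let ps := phi_skew gJ hb.
Let pa := phi_skew_adj gJ hb.
Let pp := phi_pair gJ hb.

Let lphi i j : lmap (phi i j).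
Proof. by split=> *; rewrite Dp. Qed.

Let lL i : lmap (L i).
Proof. by split=> *; rewrite ?(bilDr bL) ?(bilZr bL). Qed.

Let lN i : lmap (N i).
Proof. by split=> *; rewrite ?(bilDr bN) ?(bilZr bN). Qed.

Let lid : lmap id. Proof. by []. Qed.

Let lcomp f h : lmap f -> lmap h -> lmap (f \o h).
Proof. by move=> [fD fZ] [hD hZ]; split=> *; rewrite /= ?(hD, hZ) ?(fD, fZ). Qed.

Definition tr3 (F : U -> U -> U -> R) : R :=
  \sum_l \sum_m \sum_x F (e l) (e m) (e x).

(** [phi_pair] exchanges the first argument with the component of the value along a frame vector;
    the sum over that argument is then a quadratic form in [f]. *)
Lemma phi_trace_slot f : lmap f ->
  tr3 (fun l m x => g (phi (f l) m x) (phi l m x)) =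
  tr3 (fun l m x => g (f (phi l m x)) (phi l m x)).
Proof.
move=> lf.
transitivity (\sum_p \sum_x \sum_m \sum_l g (phi (e p) (e x) (e m)) (f (e l))
    * g (phi (e p) (e x) (e m)) (e l)).
  rewrite -[RHS]sum_reverse4; apply: eq_bigr => l _; apply: eq_bigr => m _.
  apply: eq_bigr => x _; rewrite parseval; apply: eq_bigr => p _.
  by rewrite pp (pp (e l)).
do 3! [apply: eq_bigr => ? _]; exact: lmap_diag.
Qed.

Lemma phi_trace_slot2 f : lmap f ->
  tr3 (fun l m x => g (phi l (f m) x) (phi l m x)) =
  tr3 (fun l m x => g (f (phi l m x)) (phi l m x)).
Proof.
move=> lf; rewrite -phi_trace_slot// /tr3 exchange_big.
apply: eq_bigr => l _; apply: eq_bigr => m _; apply: eq_bigr => x _ /=.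
by rewrite (ps (f (e l)) (e m)) (ps (e l) (e m)) !Dg opprK.
Qed.

Lemma phi_trace_comp f l m : lmap f ->
  \sum_x g (f (phi l m (e x))) (phi l m (e x)) =
  \sum_x g (phi l m (f (e x))) (phi l m (e x)).
Proof.
move=> lf; rewrite (trace_adjoint (A := fun x => - phi l m x)) //.
  apply: eq_bigr => x _.
  by rewrite Dp Dg [RHS]pa (hgC gJ (f _)).
by move=> u v; rewrite Dg pa opprK (hgC gJ).
Qed.

(** The modular vector of the bracket: [g h z] is minus the trace of [L z]. *)
Let h := \sum_k N (e k) (e k).

(** In the sum over [k], the third and fifth terms of [phi] cancel: they are traces of the same
    product, up to adjunction and skewness of [L]. *)
Let contraction y z :
  \sum_k g (phi (e k) y (e k)) z =
  \sum_k g (N (e k) y) (N (e k) z) + (g (L h y) z + g (N h y) z).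
Proof.
have -> : L h y = \sum_k L (N (e k) (e k)) y.
  by apply: (big_morph (L^~ y)) => [u v|]; rewrite ?(bilDl bL) ?(bil0l bL).
have -> : N h y = \sum_k N (N (e k) (e k)) y.
  by apply: (big_morph (N^~ y)) => [u v|]; rewrite ?(bilDl bN) ?(bil0l bN).
rewrite !hg_suml.
have c : \sum_k g (N (N y (e k)) (e k)) z = - \sum_k g (N (e k) (L (e k) y)) z.
  rewrite -sumrN.
  transitivity (- \sum_k g (N y (e k)) (N z (e k))).
    rewrite -sumrN; apply: eq_bigr => k _.
    by rewrite (hb_adj_sym gJ hb) (hb_skew hb z) Dg (hgC gJ) (hb_adj hb) (hgC gJ).
  rewrite (@trace_adjoint (L y) (N y) id (N z)) //; last exact: hb_adj hb _.
  rewrite -sumrN; apply: eq_bigr => k _.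
  rewrite (hb_adj_sym gJ hb) -(hb_adj hb) (hb_skew hb _ z) (hb_skew hb _ y).
  by rewrite !Dg opprK (hgC gJ).
under eq_bigr => k _ do rewrite phiE !Dg (hb_adj hb (e k)).
by rewrite !big_split /= !sumrN c; lra.
Qed.

Hypothesis rho_der : forall k l m x,
  rho k l m x + 2 *: (phi (L k l) m x + phi l (L k m) x) = 0.
Hypothesis rho_comm : forall k l m x,
  phi k (phi l m x) k + phi l m (M k k x)
    + 2 *: (phi (phi k l k) m x + phi l (phi k m k) x) =
  3 *: (L k (del k l m x) + del k l m (N k x)
       - N k (rho k l m x) - rho k l m (L k x)).

Let ldel k l m : lmap (del k l m).
Proof.
have [D Z] := lL k; have [D' Z'] := lN k.
split=> *; apply: (hg_inj gJ) => w; rewrite !delE ?(D, Z) !(Dp, D', Z', Dg); lra.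
Qed.

Let lrho k l m : lmap (rho k l m).
Proof.
have [D Z] := lL k; have [D' Z'] := lN k.
split=> *; apply: (hg_inj gJ) => w; rewrite !rhoE ?(D', Z') !(Dp, D, Z, Dg); lra.
Qed.

Let tr3D F G : tr3 (fun l m x => F l m x + G l m x) = tr3 F + tr3 G.
Proof.
rewrite /tr3 -big_split; apply: eq_bigr => l _; rewrite -big_split.
by apply: eq_bigr => m _; rewrite -big_split.
Qed.

Let tr3Z a F : tr3 (fun l m x => a * F l m x) = a * tr3 F.
Proof.
rewrite /tr3 mulr_sumr; apply: eq_bigr => l _; rewrite mulr_sumr.
by apply: eq_bigr => m _; rewrite mulr_sumr.
Qed.

Let eq_tr3 F G : (forall l m x, F l m x = G l m x) -> tr3 F = tr3 G.
Proof. by move=> FG; do 3! [apply: eq_bigr => ? _]. Qed.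

Let D k := tr3 (fun l m x => g (del k l m x) (del k l m x)).
Let A k := tr3 (fun l m x => g (phi k (phi l m x) k) (phi l m x)).

(** By [rho_der], [rho] is -2 phi ad_k. As [phi] is self-adjoint, phi ad_k is the adjoint of ad_k^*
    phi, which is [del], and has the same norm; 4 is the square of -2. *)
Let norm_rho k : tr3 (fun l m x => g (rho k l m x) (rho k l m x)) = 4 * D k.
Proof.
have -> : D k = tr3 (fun l m x => let v := phi (L k l) m x + phi l (L k m) x in
    g v v).
  transitivity (\sum_p \sum_x \sum_m \sum_l
      g (del k (e p) (e x) (e m)) (e l) * g (del k (e p) (e x) (e m)) (e l)).
    by rewrite /D /tr3; do 3! [apply: eq_bigr => ? _]; rewrite parseval.
  rewrite sum_reverse4; do 3! [apply: eq_bigr => ? _] => /=.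
  rewrite parseval; apply: eq_bigr => p _.
  by rewrite delE !Dg (hb_adj_sym gJ hb) !(pp (e p)).
rewrite -tr3Z; apply: eq_tr3 => l m x /=.
have -> : rho k l m x = - (2 *: (phi (L k l) m x + phi l (L k m) x)).
  by apply/eqP; rewrite -subr_eq0 opprK rho_der.
by rewrite !(hgNl gJ, hgNr gJ, hgZl gJ, hgZr gJ); lra.
Qed.

(** [rho_comm] is traced against [phi]. Each term quadratic in [phi] has trace [A k], with total
    weight 1 + 1 + 2 + 2 = 6, and the right-hand side has trace 3 (D k - 4 D k). *)
Let trace_identity k : 6 * A k = - 9 * D k.
Proof.
have lF : lmap (fun y => phi k y k) by split=> *; rewrite Dp.
have e1 : tr3 (fun l m x => g (phi l m (M k k x)) (phi l m x)) = A k.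
  apply: eq_bigr => l _; apply: eq_bigr => m _.
  rewrite (phi_trace_comp _ _ lF) (@trace_adjoint (fun y => phi k y k)) //.
  by apply: eq_bigr => x _; rewrite (hgC gJ).
have e2 := phi_trace_slot lF.
have e3 := phi_trace_slot2 lF.
have e4 : tr3 (fun l m x => g (L k (del k l m x)) (phi l m x)
     + g (del k l m (N k x)) (phi l m x)) = D k.
  apply: eq_bigr => l _; apply: eq_bigr => m _.
  have := @trace_adjoint (L k) (N k) (del k (e l) (e m)) (phi (e l) (e m)).
  rewrite big_split /= => ->//; last exact: hb_adj hb _.
  rewrite -big_split; apply: eq_bigr => x _ /=.
  by rewrite (hb_adj hb) -(hgDr gJ) -delE.
have e5 : tr3 (fun l m x => g (N k (rho k l m x)) (phi l m x)
     + g (rho k l m (L k x)) (phi l m x)) = 4 * D k.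
  rewrite -norm_rho; apply: eq_bigr => l _; apply: eq_bigr => m _.
  have := @trace_adjoint (N k) (L k) (rho k (e l) (e m)) (phi (e l) (e m)).
  rewrite big_split /= => ->//; last exact (hb_adj_sym gJ hb k).
  rewrite -big_split; apply: eq_bigr => x _ /=.
  by rewrite (hb_adj_sym gJ hb) -(hgDr gJ) -rhoE.
have : tr3 (fun l m x => g (phi k (phi l m x) k) (phi l m x)
    + g (phi l m (M k k x)) (phi l m x)
    + 2 * (g (phi (phi k l k) m x) (phi l m x)
         + g (phi l (phi k m k) x) (phi l m x)))
  = tr3 (fun l m x => 3 * ((g (L k (del k l m x)) (phi l m x)
     + g (del k l m (N k x)) (phi l m x))
    + - 1 * (g (N k (rho k l m x)) (phi l m x)
     + g (rho k l m (L k x)) (phi l m x)))).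
  apply: eq_tr3 => l m x.
  have := congr1 (fun y => g y (phi l m x)) (rho_comm k l m x).
  by rewrite /= !Dg; lra.
rewrite /= -/(A k) in e2 e3; rewrite !tr3D in e4 e5.
by rewrite !(tr3D, tr3Z) -/(A k) e1 e2 e3 e4 e5; lra.
Qed.

(** Traced against [phi], [rho_der] becomes six times this quantity. It serves to discard the terms
    in [h] of [contraction]. *)
Let trace_hol z : tr3 (fun l m x => g (L z (phi l m x)) (phi l m x)) = 0.
Proof.
set b := tr3 _.
have e1 : tr3 (fun l m x => g (phi l m (N z x)) (phi l m x)) = b.
  apply: eq_bigr => l _; apply: eq_bigr => m _.
  rewrite (phi_trace_comp _ _ (lL z)).
  rewrite (@trace_adjoint (L z) (N z) (phi (e l) (e m)) (phi (e l) (e m))) //.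
    by apply: eq_bigr => x _; rewrite (hgC gJ).
  exact: hb_adj hb _.
have e2 := phi_trace_slot (lL z).
have e3 := phi_trace_slot2 (lL z).
have : tr3 (fun l m x => g (L z (phi l m x)) (phi l m x)
    + g (phi l m (N z x)) (phi l m x)) =
  tr3 (fun l m x => - 2 * (g (phi (L z l) m x) (phi l m x)
    + g (phi l (L z m) x) (phi l m x))).
  apply: eq_tr3 => l m x.
  have := congr1 (fun y => g y (phi l m x)) (rho_der z l m x).
  by rewrite /= (hg0l gJ) rhoE !Dg; lra.
by rewrite !(tr3D, tr3Z) e1 e2 e3 -/b; lra.
Qed.

Let D_ge0 k : 0 <= D k.
Proof. by do 3! [apply: sumr_ge0 => ? _]; exact: hg_ge0 gJ _. Qed.

Let traces_vanish :
  \sum_k tr3 (fun l m x => g (N (e k) (phi l m x)) (N (e k) (phi l m x))) = 0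
  /\ \sum_k D (e k) = 0.
Proof.
set C := \sum_k _.
have C0 : 0 <= C.
  by rewrite /C /tr3; do 4! [apply: sumr_ge0 => ? _]; exact: hg_ge0 gJ _.
have D0 : 0 <= \sum_k D (e k) by apply: sumr_ge0.
have e1 : \sum_k A (e k) = C.
  transitivity (tr3 (fun l m x =>
      \sum_k g (N (e k) (phi l m x)) (N (e k) (phi l m x))
      + 2 * g (L h (phi l m x)) (phi l m x))).
    rewrite /A /tr3 exchange_big; apply: eq_bigr => l _ /=.
    rewrite exchange_big; apply: eq_bigr => m _ /=.
    rewrite exchange_big; apply: eq_bigr => x _ /=.
    by rewrite contraction (hb_adj hb) (hgC gJ (N h _)); lra.
  rewrite tr3D tr3Z trace_hol mulr0 addr0.
  rewrite /C /tr3 [in RHS]exchange_big; apply: eq_bigr => l _ /=.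
  rewrite [in RHS]exchange_big; apply: eq_bigr => m _ /=.
  by rewrite [in RHS]exchange_big.
have e2 : 6 * C = - 9 * \sum_k D (e k).
  by rewrite -e1 !mulr_sumr; apply: eq_bigr => k _; exact: trace_identity.
by split; lra.
Qed.

Let tr3_eq0 (F : U -> U -> U -> U) :
  (forall l m, lmap (F l m)) -> (forall l x, lmap (fun m => F l m x)) ->
  (forall m x, lmap (fun l => F l m x)) ->
  tr3 (fun l m x => g (F l m x) (F l m x)) = 0 -> forall l m x, F l m x = 0.
Proof.
move=> l1 l2 l3 F0 l m x.
apply: (lmap_eq0 (l3 m x)) => i; apply: (lmap_eq0 (l2 (e i) x)) => j.
apply: (lmap_eq0 (l1 (e i) (e j))); apply: sum_sq_eq0.
have ge0 u : 0 <= g u u := hg_ge0 gJ u.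
have := psumr_eq0P _ F0 (i := i) isT; move=> /(_ _)/psumr_eq0P.
move=> H; apply: H => //.
  by move=> a _; apply: sumr_ge0.
by move=> a _; do 2! [apply: sumr_ge0 => ? _].
Qed.

Lemma phi_eq0 i j m : phi i j m = 0.
Proof.
have [C0 D0] := traces_vanish.
have ge0 u : 0 <= g u u := hg_ge0 gJ u.
have Nphi k l n x : N k (phi l n x) = 0.
  move: k; apply: lmap_eq0.
    by split=> *; rewrite ?(bilDl bN) ?(bilZl bN).
  move=> k; move: l n x; apply: tr3_eq0.
  - by move=> l n; exact: lcomp (lN _) (lphi _ _).
  - by move=> l x; apply: lcomp (lN _) _; split=> *; rewrite Dp.
  - by move=> n x; apply: lcomp (lN _) _; split=> *; rewrite Dp.
  apply: (psumr_eq0P _ C0) => // a _.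
  by rewrite /tr3; do 3! [apply: sumr_ge0 => ? _].
have del0 k l n x : del k l n x = 0.
  move: k; apply: lmap_eq0.
    by split=> *; rewrite !delE ?(bilDl bN) ?(bilZl bN) ?(bilDl bL) ?(bilZl bL)
      ?Dp ?scalerDr // addrACA.
  move=> k; move: l n x; apply: tr3_eq0.
  - exact: ldel.
  - move=> l x; split=> *; rewrite !delE ?Dp ?(bilDr bN) ?(bilZr bN) ?scalerDr //.
    by rewrite addrACA.
  - move=> n x; split=> *; rewrite !delE ?Dp ?(bilDr bN) ?(bilZr bN) ?scalerDr //.
    by rewrite addrACA.
  by apply: (psumr_eq0P _ D0).
(* Since [N k] kills the values of [phi], only the second half of [del] remains. *)
have phiL k l n x : phi l n (L k x) = 0.
  by have := del0 k l n x; rewrite delE Nphi add0r.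
have rho0 k l n x : rho k l n x = 0.
  have -> : rho k l n x = - (2 *: (phi (L k l) n x + phi l (L k n) x)).
    by apply/eqP; rewrite -subr_eq0 opprK rho_der.
  have -> : phi (L k l) n x + phi l (L k n) x = 0.
    apply: (hg_inj gJ) => p; have := congr1 (fun y => g y l) (del0 k p x n).
    by rewrite delE /= !Dg (hb_adj_sym gJ hb) !(pp p) !(hg0l gJ).
  by rewrite scaler0 oppr0.
(* [rho = 0] gives L_k phi(x) = -phi(N_k x). Pairing this with L_k phi(x) and moving the skew
   operator [phi l n] across yields [phi l n (L k _)], which is zero by [phiL]. *)
have Lphi k l n x : L k (phi l n x) = 0.
  have := rho0 k l n x; rewrite rhoE => /eqP; rewrite addr_eq0 => /eqP e0.
  by apply: (hg_eq0 gJ); rewrite {1}e0 Dg pa opprK phiL (hg0l gJ).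
(* Every term of [phi] begins with some [L] or [N], whose adjoint kills [v]. *)
apply: (hg_eq0 gJ); rewrite {1}phiE; set v := phi i j m.
have NL u w : g (N u w) v = g w (L u v) := hb_adj_sym gJ hb u w v.
have Nv k : N k v = 0 by exact: Nphi.
have Lv k : L k v = 0 by exact: Lphi.
by rewrite !Dg !NL !Lv !(hg0r gJ) !(hb_adj hb) !Nv !(hg0r gJ); lra.
Qed.

End Traces.

(** * Orthonormal frames *)

Section OrthonormalFrame.
Context {R : realType} {m : nat}.
Context {g : 'rV[R]_m -> 'rV[R]_m -> R} {J : 'rV[R]_m -> 'rV[R]_m}.
Context (gJ : hermitian_space g J).

Let pairing k (e : 'I_k -> 'rV[R]_m) : 'M[R]_(m, k) :=
  \matrix_(j, i) g (delta_mx 0 j) (e i).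

Let pairingE k (e : 'I_k -> 'rV[R]_m) u i :
  (u *m pairing e) 0 i = g u (e i).
Proof.
rewrite !mxE {2}(row_sum_delta u) (hg_suml gJ); apply: eq_bigr => j _.
by rewrite mxE (hgZl gJ).
Qed.

Lemma orthonormal_exists k : (k <= m)%N ->
  exists e : 'I_k -> 'rV[R]_m, forall i j, g (e i) (e j) = (i == j)%:R.
Proof.
elim: k => [_|k IH km]; first by exists (fun=> 0) => -[].
have [e eP] := IH (ltnW km).
(* [pairing e] has [k < m] columns, so its left kernel contains a nonzero vector, orthogonal to
   every [e i]. *)
have : kermx (pairing e) != 0.
  rewrite -mxrank_eq0 mxrank_ker subn_eq0 -ltnNge.
  exact: leq_ltn_trans (rank_leq_col _) km.
move=> /rowV0Pn[x /sub_kermxP xe x0].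
pose n := (Num.sqrt (g x x))^-1; pose y := n *: x.
have gx := hg_gt0 gJ x0.
have yy : g y y = 1.
  rewrite /y (hgZl gJ) (hgZr gJ) mulrA -expr2 /n exprVn sqr_sqrtr ?ltW//.
  by rewrite mulVf// gt_eqF.
have ye i : g y (e i) = 0 by rewrite (hgZl gJ) -pairingE xe mxE mulr0.
exists (fun i : 'I_k.+1 => if unlift ord0 i is Some i' then e i' else y).
move=> i j; case: unliftP => [i'|] ->; case: unliftP => [j'|] -> /=.
- by rewrite eP (inj_eq lift_inj).
- by rewrite (hgC gJ) ye.
- by rewrite ye.
- by [].
Qed.

Lemma orthonormal_frame :
  exists e : 'I_m -> 'rV[R]_m, forall u, u = \sum_i g u (e i) *: e i.
Proof.
have [e eP] := orthonormal_exists (leqnn m); exists e => u.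
pose E := \matrix_i e i.
have EB : E *m pairing e = 1%:M.
  apply/matrixP => i j; rewrite [RHS]mxE -eP -pairingE [LHS]mxE [RHS]mxE.
  by apply: eq_bigr => k _; congr (_ * _); rewrite mxE.
have {1}-> : u = u *m pairing e *m E by rewrite -mulmxA mulmx1C// mulmx1.
rewrite mulmx_sum_row; apply: eq_bigr => i _.
by rewrite pairingE rowK.
Qed.

End OrthonormalFrame.

(** * Covariant derivatives of tensor fields *)

Section RowDerivatives.
Context {R : realType} {V : normedModType R} {m : nat}.
Implicit Types (p a : V).

Lemma differentiable_row (F : V -> 'rV[R]_m) p :
  (forall j, differentiable (fun x => F x 0 j) p) -> differentiable F p.
Proof.
move=> dF.
have -> : F = \sum_j (fun x => F x 0 j *: delta_mx 0 j : 'rV[R]_m).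
  by apply/funext => x; rewrite fct_sumE -row_sum_delta.
by apply: differentiable_sum => j; apply: differentiableZl.
Qed.

Lemma differentiable_rowE (F : V -> 'rV[R]_m) p j :
  differentiable F p -> differentiable (fun x => F x 0 j) p.
Proof.
by move=> dF; apply: differentiable_comp dF (differentiable_coord _ _ _).
Qed.

Lemma derive_rowE (F : V -> 'rV[R]_m) p a j :
  differentiable F p -> 'D_a F p 0 j = 'D_a (fun x => F x 0 j) p.
Proof. by move=> dF; rewrite derive_mx ?mxE//; exact: diff_derivable. Qed.

Lemma differentiable_scale (h : V -> R) (F : V -> 'rV[R]_m) p :
  differentiable h p -> differentiable F p ->
  differentiable (fun x => h x *: F x) p.
Proof.
move=> dh dF; apply: differentiable_row => j.
have -> : (fun x => (h x *: F x) 0 j) = h * (fun x => F x 0 j).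
  by apply/funext => x; rewrite mxE.
by apply: differentiableM dh (differentiable_rowE j dF).
Qed.

Lemma derive_scale (h : V -> R) (F : V -> 'rV[R]_m) p a :
  differentiable h p -> differentiable F p ->
  'D_a (fun x => h x *: F x) p = h p *: 'D_a F p + 'D_a h p *: F p.
Proof.
move=> dh dF; apply/rowP => j.
apply: etrans (derive_rowE _ _ (differentiable_scale dh dF)) _.
have -> : (fun x => (h x *: F x) 0 j) = h * (fun x => F x 0 j).
  by apply/funext => x; rewrite mxE.
rewrite deriveM; [|exact: diff_derivable|].
  rewrite [RHS]mxE [in RHS]mxE [X in _ = _ + X]mxE.
  rewrite derive_rowE//.
  by rewrite [X in _ = _ + X]mulrC.
by apply: diff_derivable; exact: differentiable_rowE.
Qed.

Lemma differentiable_bigsum n (F : 'I_n -> V -> 'rV[R]_m) p :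
  (forall i, differentiable (F i) p) ->
  differentiable (fun x => \sum_i F i x) p.
Proof.
move=> dF; have -> : (fun x => \sum_i F i x) = \sum_i F i.
  by apply/funext => x; rewrite fct_sumE.
exact: differentiable_sum.
Qed.

Lemma derive_bigsum n (F : 'I_n -> V -> 'rV[R]_m) p a :
  (forall i, differentiable (F i) p) ->
  'D_a (fun x => \sum_i F i x) p = \sum_i 'D_a (F i) p.
Proof.
move=> dF; have -> : (fun x => \sum_i F i x) = \sum_i F i.
  by apply/funext => x; rewrite fct_sumE.
by rewrite derive_sum// => i; exact: diff_derivable.
Qed.

End RowDerivatives.

Lemma bil_sum_delta (R : realType) (m : nat)
    (B : 'rV[R]_m -> 'rV[R]_m -> 'rV[R]_m) u v : bilinear2 B ->
  B u v = \sum_i \sum_j (u 0 i * v 0 j) *: B (delta_mx 0 i) (delta_mx 0 j).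
Proof.
move=> bB.
rewrite {1}(row_sum_delta u) (big_morph (B^~ v) (fun a b => bilDl bB a b v)
  (bil0l bB v)).
apply: eq_bigr => i _; rewrite (bilZl bB) {1}(row_sum_delta v).
rewrite (big_morph (B _) (bilDr bB _) (bil0r bB _)) scaler_sumr.
by apply: eq_bigr => j _; rewrite (bilZr bB) scalerA.
Qed.

Section TensorDerivatives.
Context {R : realType} {m : nat}.
Local Notation E := 'rV[R]_m.
Context (B : E -> E -> E -> E) (p : E).
Context (bB : \forall x \near p, bilinear2 (B x)).
Context (dB : forall u v, differentiable (fun x => B x u v) p).

Let expand (F H : E -> E) : \forall x \near p, B x (F x) (H x) =
  \sum_i \sum_j (F x 0 i * H x 0 j) *: B x (delta_mx 0 i) (delta_mx 0 j).
Proof. by apply: filterS bB => x bx; exact: bil_sum_delta. Qed.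

Let dFH (F H : E -> E) i j : differentiable F p -> differentiable H p ->
  differentiable (fun x => F x 0 i * H x 0 j) p.
Proof.
move=> dF dH.
exact: (differentiableM (differentiable_rowE i dF) (differentiable_rowE j dH)).
Qed.

Let dterm (F H : E -> E) i j : differentiable F p -> differentiable H p ->
  differentiable
    (fun x => (F x 0 i * H x 0 j) *: B x (delta_mx 0 i) (delta_mx 0 j)) p.
Proof. by move=> dF dH; apply: differentiable_scale (dB _ _); exact: dFH. Qed.

Lemma differentiable_tensor (F H : E -> E) :
  differentiable F p -> differentiable H p ->
  differentiable (fun x => B x (F x) (H x)) p.
Proof.
move=> dF dH; apply: (@near_eq_diff _ _ _ (fun x => \sum_i \sum_j
  (F x 0 i * H x 0 j) *: B x (delta_mx 0 i) (delta_mx 0 j))).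
  by apply: filterS (expand F H) => x ->.
by do 2! [apply: differentiable_bigsum => ?]; exact: dterm.
Qed.

Lemma derive_tensor (F H : E -> E) a :
  differentiable F p -> differentiable H p ->
  'D_a (fun x => B x (F x) (H x)) p =
  'D_a (fun x => B x (F p) (H p)) p
  + B p ('D_a F p) (H p) + B p (F p) ('D_a H p).
Proof.
move=> dF dH.
have De (F' H' : E -> E) : differentiable F' p -> differentiable H' p ->
    'D_a (fun x => B x (F' x) (H' x)) p = \sum_i \sum_j
    ((F' p 0 i * H' p 0 j) *: 'D_a (fun x => B x (delta_mx 0 i) (delta_mx 0 j)) p
     + (F' p 0 i * 'D_a H' p 0 j + H' p 0 j * 'D_a F' p 0 i)
       *: B p (delta_mx 0 i) (delta_mx 0 j)).
  move=> dF' dH'; apply: etrans (near_eq_derive a (expand F' H')) _.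
  apply: etrans (derive_bigsum a _) _.
    by move=> i; apply: differentiable_bigsum => j; exact: dterm.
  apply: eq_bigr => i _; apply: etrans (derive_bigsum a _) _.
    by move=> j; exact: dterm.
  apply: eq_bigr => j _.
  apply: etrans (derive_scale a (dFH i j dF' dH') (dB _ _)) _.
  congr (_ + _ *: _).
  have dFi := differentiable_rowE i dF'; have dHj := differentiable_rowE j dH'.
  rewrite !derive_rowE//.
  exact (deriveM (diff_derivable dFi) (diff_derivable dHj)).
rewrite De// (De (cst (F p)) (cst (H p))) //.
have bp := nbhs_singleton bB.
rewrite (bil_sum_delta _ (H p) bp) (bil_sum_delta (F p) _ bp).
rewrite -!big_split; apply: eq_bigr => i _ /=.
rewrite -!big_split; apply: eq_bigr => j _ /=.
rewrite !derive_cst !mxE !mulr0 addr0 scale0r addr0 -addrA -scalerDl.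
congr (_ + _ *: _); ring.
Qed.

End TensorDerivatives.

(** * Leibniz calculus at a point *)

Section CovariantCalculus.
Context {R : realType} {m : nat}.
Local Notation E := 'rV[R]_m.

(* [F'] is the covariant derivative at [p] of the vector field [F], for a
   connection with Christoffel form [Gp] at [p]. *)
Definition covd (Gp : E -> E -> E) (p : E) (F : E -> E) (F' : E -> E) :=
  differentiable F p /\ forall a, 'D_a F p + Gp a (F p) = F' a.

(** Bilinearity is required near [p], since the Leibniz rule expands [B x] in coordinates before
    differentiating. *)
Definition tensord (Gp : E -> E -> E) (p : E) (B : E -> E -> E -> E)
    (B' : E -> E -> E -> E) :=
  [/\ \forall x \near p, bilinear2 (B x),
      forall u v, differentiable (fun x => B x u v) p &
      forall a u v, B' a u v = 'D_a (fun x => B x u v) p + Gp a (B p u v)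
        - B p (Gp a u) v - B p u (Gp a v)].

Context {Gp : E -> E -> E} {p : E} (bG : bilinear2 Gp).
Local Notation cd := (covd Gp p).
Implicit Types F H : E -> E.

Lemma covd_ext F F' F'' : cd F F' -> (forall a, F' a = F'' a) -> cd F F''.
Proof. by move=> [dF eF] e; split=> // a; rewrite eF. Qed.

Lemma covd_unique F F' F'' : cd F F' -> cd F F'' -> forall a, F' a = F'' a.
Proof. by move=> [_ e] [_ e'] a; rewrite -e. Qed.

Lemma covd_cst u : cd (cst u) (fun a => Gp a u).
Proof. by split=> // a; rewrite derive_cst add0r. Qed.

Lemma covdD F F' H H' : cd F F' -> cd H H' ->
  cd (fun x => F x + H x) (fun a => F' a + H' a).
Proof.
move=> [dF eF] [dH eH]; split=> [|a]; first exact: differentiableD.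
rewrite (bilDr bG) -eF -eH addrACA; congr (_ + _).
by apply: deriveD; apply: diff_derivable.
Qed.

Lemma covdZ (c : R) F F' : cd F F' -> cd (fun x => c *: F x) (fun a => c *: F' a).
Proof.
move=> [dF eF]; split=> [|a]; first exact: differentiableZ.
rewrite (bilZr bG) -eF scalerDr; congr (_ + _).
by apply: deriveZ; apply: diff_derivable.
Qed.

Lemma covdN F F' : cd F F' -> cd (fun x => - F x) (fun a => - F' a).
Proof.
move=> /(covdZ (-1)) [dF eF].
have -> : (fun x => - F x) = (fun x => -1 *: F x).
  by apply/funext => x; rewrite scaleN1r.
by split=> // a; rewrite eF scaleN1r.
Qed.

Lemma covdB F F' H H' : cd F F' -> cd H H' ->
  cd (fun x => F x - H x) (fun a => F' a - H' a).
Proof. by move=> cF /covdN; exact: covdD. Qed.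

Lemma covd_tensor B B' F F' H H' : tensord Gp p B B' -> cd F F' -> cd H H' ->
  cd (fun x => B x (F x) (H x))
     (fun a => B' a (F p) (H p) + B p (F' a) (H p) + B p (F p) (H' a)).
Proof.
move=> [bB dB eB] [dF eF] [dH eH]; split; first exact: differentiable_tensor.
move=> a; rewrite derive_tensor// eB -eF -eH.
have b := nbhs_singleton bB.
rewrite (bilDl b) (bilDr b).
move: ('D_a (fun x => B x (F p) (H p)) p) (B p ('D_a F p) (H p))
  (B p (F p) ('D_a H p)) (Gp a _) (B p (Gp a _) _) (B p _ (Gp a _)).
by move=> X Y Z W S Q; apply/rowP => j; rewrite !mxE; lra.
Qed.

Lemma covd_lmap J F F' : lmap J -> (forall a u, Gp a (J u) = J (Gp a u)) ->
  cd F F' -> cd (fun x => J (F x)) (fun a => J (F' a)).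
Proof.
move=> lJ GJ [dF eF].
have JE u : J u = \sum_j u 0 j *: J (delta_mx 0 j).
  have [JD JZ] := lJ; have J0 : J 0 = 0 by have := JZ 0 0; rewrite !scale0r.
  rewrite {1}(row_sum_delta u) (big_morph J JD J0).
  by apply: eq_bigr => j _; rewrite JZ.
have JFE : (fun x => J (F x)) =
    (fun x => \sum_j F x 0 j *: cst (J (delta_mx 0 j)) x).
  by apply/funext => x; rewrite JE.
have dt j : differentiable (fun x => F x 0 j *: cst (J (delta_mx 0 j)) x) p.
  by apply: differentiable_scale => //; exact: differentiable_rowE.
split; first by rewrite JFE; apply: differentiable_bigsum.
move=> a; rewrite GJ -eF lJ.1; congr (_ + _).
rewrite JFE; apply: etrans (derive_bigsum a dt) _.
rewrite [RHS]JE; apply: eq_bigr => j _.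
apply: etrans (derive_scale a (differentiable_rowE j dF) _) _ => //.
by rewrite derive_cst scaler0 add0r derive_rowE.
Qed.

(** The first-order correction by [Gp (x - p) u] cancels the Christoffel term at [p]. Along such
    fields the Leibniz rule retains only derivatives of the tensors, so a tensor identity can be
    differentiated. *)
Lemma covd_parallel u : exists2 F, F p = u & cd F (fun=> 0).
Proof.
pose K (x a v : E) := Gp a v; have bK : \forall x \near p, bilinear2 (K x).
  by near=> x.
have dK a v : differentiable (fun x => K x a v) p.
  exact: (differentiable_cst (Gp a v)).
exists (fun x => u - Gp (x - p) u).
  by rewrite subrr (bil0l bG) subr0.
have di : differentiable (fun x : E => x - p) p.
  apply: differentiableB; last exact: differentiable_cst.
  by have [] := is_diff_id p.
have dt := differentiable_tensor bK dK di (differentiable_cst (u : E) p).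
split; first by apply: differentiableB dt.
move=> a.
have -> : 'D_a (fun x => u - Gp (x - p) u) p = - Gp a u.
  apply: etrans (deriveB _ _) _ => //; first exact: diff_derivable dt.
  rewrite derive_cst sub0r; congr (- _).
  have e : 'D_a (fun x => Gp (x - p) u) p = _ :=
    derive_tensor bK dK a di (differentiable_cst (u : E) p).
  rewrite e /K /= !derive_cst (bil0r bG) addr0 add0r; congr (Gp _ u).
  apply: etrans (deriveB _ _) _ => //; rewrite derive_id derive_cst.
  exact: subr0.
by rewrite subrr (bil0l bG) subr0 addNr.
Unshelve. all: by end_near.
Qed.

Lemma covd_near0 F F' : (\forall x \near p, F x = 0) -> cd F F' ->
  forall a, F' a = 0.
Proof.
move=> F0 [dF eF] a; rewrite -eF (nbhs_singleton F0) (bil0r bG) addr0.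
rewrite -[RHS](derive_cst (0 : E) p a); apply: near_eq_derive.
by apply: filterS F0 => x ->.
Qed.

End CovariantCalculus.

(** * Connections on an open set *)

Section LocalDefinitions.
Context {R : realType} {m : nat}.
Local Notation E := 'rV[R]_m.
Context (G : E -> E -> E -> E).

(* [G x u v] is the Christoffel form; [dtors x a] is [D_a T] and [hess x u v w]
   is [D_u D_v w] for constant fields. *)
Definition ltors x u v := G x u v - G x v u.

Definition dtors x a u v := 'D_a (fun y => ltors y u v) x
  + G x a (ltors x u v) - ltors x (G x a u) v - ltors x u (G x a v).

Definition hess x u v w := 'D_u (fun y => G y v w) x + G x u (G x v w).

Definition lcurv x u v w := hess x u v w - hess x v u w.

End LocalDefinitions.

Section LocalConnection.
Context {R : realType} {m : nat}.
Local Notation E := 'rV[R]_m.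
Context {A : set E} (oA : open A) {G : E -> E -> E -> E}.
Local Notation ltors := (ltors G).
Local Notation dtors := (dtors G).
Local Notation hess := (hess G).
Local Notation lcurv := (lcurv G).
Hypothesis bG : forall x, bilinear2 (G x).
Hypothesis dG : forall u v x, A x -> differentiable (fun y => G y u v) x.

Lemma near_open (P : E -> Prop) p : A p -> (forall x, A x -> P x) ->
  \forall x \near p, P x.
Proof. by move=> Ap AP; apply: filterS AP _; exact: open_nbhs_nbhs. Qed.

Lemma ltors_bilinear x : bilinear2 (ltors x).
Proof.
have b := bG x; rewrite /ltors; split=> *; apply/rowP => j;
  by rewrite ?(bilDl b, bilDr b, bilZl b, bilZr b) !mxE; lra.
Qed.

Lemma ltors_tensord p : A p -> tensord (G p) p ltors (dtors p).
Proof.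
move=> Ap; split=> [|u v|//]; first by near=> x; exact: ltors_bilinear.
by apply: differentiableB; exact: dG.
Unshelve. all: by end_near.
Qed.

Lemma covd_hess p v w : A p -> covd (G p) p (fun x => G x v w) (hess p ^~ v ^~ w).
Proof. by move=> Ap; split=> //; exact: dG. Qed.

Lemma tensord_intro p B B' : (\forall x \near p, bilinear2 (B x)) ->
  (forall u v, covd (G p) p (fun x => B x u v)
    (fun a => B' a u v + B p (G p a u) v + B p u (G p a v))) ->
  tensord (G p) p B B'.
Proof.
move=> bB cB; split=> // [u v|a u v]; first by have [] := cB u v.
by have [_ ->] := cB u v; apply/rowP => j; rewrite !mxE; lra.
Qed.

Lemma tensord_cst p B B' u v : tensord (G p) p B B' ->
  covd (G p) p (fun x => B x u v)
    (fun a => B' a u v + B p (G p a u) v + B p u (G p a v)).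
Proof. by move=> tB; apply: covd_tensor tB _ _; exact: covd_cst. Qed.

(** Constant fields have zero brackets, so their torsion is [G x b c - G x c b]. Differentiating
    this covariantly and summing cyclically gives the identity. *)
Lemma first_bianchi p u v w : A p ->
  lcurv p u v w + lcurv p v w u + lcurv p w u v =
  dtors p u v w + dtors p v w u + dtors p w u v + jac (ltors p) u v w.
Proof.
move=> Ap.
have H a b c : hess p a b c - hess p a c b =
    dtors p a b c + ltors p (G p a b) c + ltors p b (G p a c).
  have c1 := covdB (bG p) (covd_hess b c Ap) (covd_hess c b Ap).
  exact: (covd_unique c1 (tensord_cst b c (ltors_tensord Ap)) a).
have := H w u v; have := H v w u; have := H u v w; move=> h1 h2 h3 {H}.
have b := ltors_bilinear p.
have tE x y : ltors p x y = G p x y - G p y x by [].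
have sk x y : ltors p y x = - ltors p x y by rewrite /ltors opprB.
have e x y z :
    ltors p (ltors p x y) z = ltors p (G p x y) z + ltors p z (G p y x).
  by rewrite [ltors p x y]tE (bilDl b) (bilNl b) -sk.
rewrite /jac !e /lcurv.
move: (hess p) (dtors p) h1 h2 h3 => h d h1 h2 h3; apply/rowP => j.
have := congr1 (fun r : E => r 0 j) h1; have := congr1 (fun r : E => r 0 j) h2.
have := congr1 (fun r : E => r 0 j) h3; rewrite /= !mxE; lra.
Qed.

(** The left side is the curvature of D + B on constant fields. The term [B p (ltors p u v) w]
    corrects for the torsion of D in the antisymmetrized derivative of B. *)
Lemma curvature_shift B B' p u v w : A p -> tensord (G p) p B B' ->
  let G' x u v := G x u v + B x u v in
  ('D_u (fun x => G' x v w) p + G' p u (G' p v w))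
  - ('D_v (fun x => G' x u w) p + G' p v (G' p u w)) =
  lcurv p u v w + B' u v w - B' v u w + B p (ltors p u v) w
  + B p u (B p v w) - B p v (B p u w).
Proof.
move=> Ap tB G'.
pose X a b := 'D_a (fun x => G' x b w) p + G' p a (G' p b w).
have [/nbhs_singleton bB _ _] := tB.
have H a b : X a b =
    hess p a b w + (B' a b w + B p (G p a b) w + B p b (G p a w))
    + B p a (G p b w) + B p a (B p b w).
  have [_ <-] := covdD (bG p) (covd_hess b w Ap) (tensord_cst b w tB).
  by rewrite /X /G' (bilDr bB) !addrA.
have tE : B p (ltors p u v) w = B p (G p u v) w - B p (G p v u) w.
  by rewrite /ltors (bilDl bB) (bilNl bB).
rewrite -/(X u v) -/(X v u) tE /lcurv.
move: (hess p) X H => h X H; rewrite !H; apply/rowP => j; rewrite !mxE; lra.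
Qed.

End LocalConnection.

(** * Derivatives of L, N and phi *)

Section ComplexTensors.
Context {R : realType} {m : nat}.
Local Notation E := 'rV[R]_m.
Context {Gp : E -> E -> E} {p : E} (bG : bilinear2 Gp).
Context {J : E -> E} (lJ : lmap J) (GJ : forall a u, Gp a (J u) = J (Gp a u)).
Local Notation cd := (covd Gp p).

Lemma tensord_hol B B' : tensord Gp p B B' ->
  tensord Gp p (fun x => hol J (B x)) (fun a => hol J (B' a)).
Proof.
move=> tB; have [bB dB eB] := tB; have [JD JZ] := lJ.
apply: tensord_intro.
  apply: filterS bB => x b; rewrite /hol; split=> *; apply/rowP => j;
  by rewrite ?JD ?JZ ?(bilDl b, bilDr b, bilZl b, bilZr b) !mxE; lra.
move=> u v.
apply: covd_ext (covdZ bG 2^-1 (covdB bG (tensord_cst u v tB)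
  (tensord_cst (J u) (J v) tB))) _ => a.
by rewrite /hol !GJ; apply/rowP => j; rewrite !mxE; lra.
Qed.

Lemma tensord_adj B B' : tensord Gp p B B' ->
  tensord Gp p (fun x => adj J (B x)) (fun a => adj J (B' a)).
Proof.
move=> tB; have [bB dB eB] := tB; have [JD JZ] := lJ.
apply: tensord_intro.
  apply: filterS bB => x b; rewrite /adj; split=> *;
  rewrite ?JD ?JZ ?(bilDl b, bilDr b, bilZl b, bilZr b) ?JD ?JZ;
  by apply/rowP => j; rewrite !mxE; lra.
move=> v u.
apply: covd_ext (covdZ bG 2^-1 (covdD bG (tensord_cst u v tB)
  (covd_lmap lJ GJ (tensord_cst u (J v) tB)))) _ => a.
by rewrite /adj !GJ !JD; apply/rowP => j; rewrite !mxE; lra.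
Qed.

Context {L N : E -> E -> E -> E} {M : E -> E -> E -> E}.
Context (bL : bilinear2 (L p)) (bN : bilinear2 (N p)).
Hypothesis tL :
  tensord Gp p L (fun a u v => 3^-1 *: phi (L p) (N p) u v a).
Hypothesis tN : tensord Gp p N (fun a u v => 3^-1 *: M a u v).

Lemma covd_phi F F' H H' I I' : cd F F' -> cd H H' -> cd I I' ->
  cd (fun x => phi (L x) (N x) (F x) (H x) (I x))
     (fun a => 3^-1 *: dphi (L p) (N p) M a (F p) (H p) (I p)
       + phi (L p) (N p) (F' a) (H p) (I p)
       + phi (L p) (N p) (F p) (H' a) (I p)
       + phi (L p) (N p) (F p) (H p) (I' a)).
Proof.
move=> cF cH cI.
have c1 := covd_tensor tL (covd_tensor tN cI cF) cH.
have c2 := covd_tensor tL cF (covd_tensor tN cI cH).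
have c3 := covd_tensor tN cI (covd_tensor tL cF cH).
have c4 := covd_tensor tN (covd_tensor tN cF cI) cH.
have c5 := covd_tensor tN (covd_tensor tN cH cI) cF.
have c := covdB bG (covdD bG (covdB bG (covdD bG c1 c2) c3) c4) c5.
have -> : (fun x => phi (L x) (N x) (F x) (H x) (I x)) = (fun x =>
    L x (N x (I x) (F x)) (H x) + L x (F x) (N x (I x) (H x))
    - N x (I x) (L x (F x) (H x)) + N x (N x (F x) (I x)) (H x)
    - N x (N x (H x) (I x)) (F x)) by apply/funext => x; rewrite phiE.
apply: covd_ext c _ => a; rewrite /dphi -lock /=.
rewrite (phiE _ _ (F' a)) (phiE _ _ _ (H' a)) (phiE _ _ _ _ (I' a)).
rewrite !(bilDl bL, bilDr bL, bilDl bN, bilDr bN, bilZl bL, bilZr bL,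
  bilZl bN, bilZr bN).
by apply/rowP => j; rewrite !mxE; lra.
Qed.

End ComplexTensors.

Lemma addr_shuffle (V : zmodType) (x y z w v : V) :
  x + (y + z) + (w + v) = x + z + w + (y + v).
Proof. by rewrite [y + z]addrC (addrA x) addrACA. Qed.

Lemma subr_shuffle (V : zmodType) (x y z a b : V) :
  a - b = (x + y + z + a) - (x + z + y + b).
Proof.
by rewrite [x + z + y]addrAC opprD addrACA subrr add0r.
Qed.

(** * Differentiated identities on an open set, and vanishing of phi *)

Section ParallelTorsion.
Context {R : realType} {m : nat}.
Local Notation E := 'rV[R]_m.
Context {A : set E} (oA : open A) {G : E -> E -> E -> E}.
Context (bG : forall x, bilinear2 (G x)).
Context (dG : forall u v x, A x -> differentiable (fun y => G y u v) x).
Context {g : E -> E -> E -> R} {J : E -> E}.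
Context (gJ : forall x, A x -> hermitian_space (g x) J).
Local Notation T := (ltors G).
Context {L N : E -> E -> E -> E} {M : E -> E -> E -> E -> E}.
Local Notation phi x := (phi (L x) (N x)).
Local Notation rho x := (rho (L x) (N x)).
Context (hb : forall x, A x -> herm_bracket (g x) J (L x) (N x)).
Context (TE : forall x, A x ->
  forall u v, T x u v = L x u v + N x v u - N x u v).
Context (M_adj : forall x, A x -> forall u v a w,
  g x (phi x u v a) w = g x v (M x a u w)).
Context (tL : forall p, A p ->
  tensord (G p) p L (fun a u v => 3^-1 *: phi p u v a)).
Context (tN : forall p, A p ->
  tensord (G p) p N (fun a u v => 3^-1 *: M p a u v)).
Context (jacL : forall x, A x -> forall u v w, jac (L x) u v w = 0).
Context (RJ : forall x, A x -> forall u v w,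
  lcurv G x (J u) (J v) w = lcurv G x u v w).

Let bL x (Ax : A x) : bilinear2 (L x) := hbL (hb Ax).
Let bN x (Ax : A x) : bilinear2 (N x) := hbN (hb Ax).

Let cphi p (Ap : A p) := covd_phi (bG p) (bL Ap) (bN Ap) (tL Ap) (tN Ap).

Let near_A p (P : E -> Prop) : A p -> (forall x, A x -> P x) ->
  \forall x \near p, P x.
Proof. exact: near_open. Qed.

Let phi0 x : A x -> [/\ forall j k, phi x 0 j k = 0,
  forall i k, phi x i 0 k = 0 & forall i j, phi x i j 0 = 0].
Proof.
move=> Ax; split=> i j.
- by have := phiZ1 (gJ Ax) (hb Ax) 0 0 i j; rewrite !scale0r.
- by have := phiZ2 (gJ Ax) (hb Ax) 0 i 0 j; rewrite !scale0r.
- by have := phiZ3 (gJ Ax) (hb Ax) 0 i j 0; rewrite !scale0r.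
Qed.

Let third (v : E) : 3^-1 *: v = 0 -> v = 0.
Proof. by move/eqP; rewrite scaler_eq0 invr_eq0 pnatr_eq0 => /eqP. Qed.

Let cocycle p : A p -> forall i j k a,
  phi p (L p i j) k a + L p (phi p i j a) k
  + (phi p (L p j k) i a + L p (phi p j k a) i)
  + (phi p (L p k i) j a + L p (phi p k i a) j) = 0.
Proof.
move=> Ap i j k a.
have [F Fi cF] := covd_parallel (bG p) (p := p) i.
have [H Hj cH] := covd_parallel (bG p) (p := p) j.
have [I Ik cI] := covd_parallel (bG p) (p := p) k.
have c := covdD (bG p) (covdD (bG p)
  (covd_tensor (tL Ap) (covd_tensor (tL Ap) cF cH) cI)
  (covd_tensor (tL Ap) (covd_tensor (tL Ap) cH cI) cF))
  (covd_tensor (tL Ap) (covd_tensor (tL Ap) cI cF) cH).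
have z : \forall x \near p, L x (L x (F x) (H x)) (I x)
    + L x (L x (H x) (I x)) (F x) + L x (L x (I x) (F x)) (H x) = 0.
  apply: near_A Ap _ => x Ax.
  exact: jacL.
have := covd_near0 (bG p) z c a; rewrite /= Fi Hj Ik.
rewrite !(bil0l (bL Ap), bil0r (bL Ap)) !addr0 !(bilZl (bL Ap)) -!scalerDr.
exact: third.
Qed.

(** The Ricci identity for the tensor [L]: [D_l, D_n] of the field [F] is computed from the
    curvature and by the Leibniz rule. J-invariance of the curvature in [l], [n] then passes to
    [Q]. *)
Let ricci p : A p -> forall l n i j, let Q l n :=
  dphi (L p) (N p) (M p) l i j n - dphi (L p) (N p) (M p) n i j l
  + 3 *: phi p i j (T p l n) in
  Q (J l) (J n) = Q l n.
Proof.
move=> Ap l0 n0 i j Q.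
pose F x := L x i j.
have dF x : A x -> differentiable F x.
  by move=> Ax; have [_ d _] := tL Ax; exact: d.
pose W a x := 3^-1 *: phi x i j a + L x (G x a i) j + L x i (G x a j).
have WE a x : A x -> 'D_a F x + G x a (F x) = W a x.
  by move=> Ax; have [_ ->] := tensord_cst i j (tL Ax).
have cW a := covdD (bG p) (covdD (bG p)
  (covdZ (bG p) 3^-1 (cphi Ap (covd_cst i) (covd_cst j) (covd_cst a)))
  (covd_tensor (tL Ap) (covd_hess dG a i Ap) (covd_cst j)))
  (covd_tensor (tL Ap) (covd_cst i) (covd_hess dG a j Ap)).
have tG : \forall x \near p, bilinear2 (G x) by near=> x.
have dGF a : differentiable (fun x => G x a (F x)) p.
  by apply: (differentiable_tensor tG _ (differentiable_cst a p) (dF p Ap));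
    move=> u v; exact: dG.
have DFE a : \forall x \near p, W a x - G x a (F x) = 'D_a F x.
  by apply: near_A Ap _ => x Ax; rewrite -WE// addrK.
(* The second derivatives of [F] come from its first-order equation: near [p], ['D_a F] is
   [W a - G a F], whose ingredients are differentiable. *)
have dDF a : differentiable ('D_a F) p.
  apply: near_eq_diff (DFE a) _; apply: differentiableB (dGF a).
  by have [] := cW a.
have sw l n : 'D_l ('D_n F) p = 'D_n ('D_l F) p.
  by apply: schwarz_row => //; apply: near_A Ap _ => x; exact: dF.
have DW a b : 'D_b (W a) p + G p b (W a p) =
    'D_b ('D_a F) p + G p a ('D_b F p) + G p b ('D_a F p) + hess G p b a (F p).
  have e1 : 'D_b (W a) p = 'D_b (fun x => 'D_a F x + G x a (F x)) p.
    by apply: near_eq_derive; apply: near_A Ap _ => x Ax; exact (esym (WE a x Ax)).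
  have e2 : 'D_b (fun x => 'D_a F x + G x a (F x)) p =
     'D_b ('D_a F) p + 'D_b (fun x => G x a (F x)) p.
    by apply: deriveD; apply: diff_derivable.
  have e3 : 'D_b (fun x => G x a (F x)) p =
      'D_b (fun x => G x a (F p)) p + G p a ('D_b F p).
    apply: etrans (derive_tensor tG _ b (differentiable_cst a p) (dF p Ap)) _.
      by move=> u v; exact: dG.
    by rewrite derive_cst (bil0l (bG p)) addr0.
  apply: etrans (congr2 +%R (etrans e1 (etrans e2 (congr1 _ e3)))
    (congr1 (G p b) (esym (WE a p Ap)))) _.
  apply: etrans (congr1 _ (bilDr (bG p) _ _ _)) _.
  exact: addr_shuffle.
have curvF l n : lcurv G p l n (F p) =
    ('D_l (W n) p + G p l (W n p)) - ('D_n (W l) p + G p n (W l p)).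
  have e1 := etrans (DW n l) (congr1
    (fun s => s + G p n ('D_l F p) + G p l ('D_n F p) + hess G p l n (F p)) (sw l n)).
  apply: etrans _ (esym (congr2 (fun s t => s - t) e1 (DW l n))).
  exact: subr_shuffle.
(* The factor 9 is 3 * 3: the derivative of [L] is [phi / 3] and that of [phi] is [dphi / 3]. *)
have QE l n : Q l n = 9 *: (lcurv G p l n (F p) - L p (lcurv G p l n i) j
    - L p i (lcurv G p l n j)).
  rewrite curvF (cW n).2 (cW l).2 /= /Q /lcurv /ltors.
  move: (hess G p) => h.
  rewrite (phiD3 (gJ Ap) (hb Ap)) (phiN3 (gJ Ap) (hb Ap)).
  have b := bL Ap.
  rewrite !(bilDl b, bilDr b, bilNl b, bilNr b, bilZl b, bilZr b).
  by apply/rowP => s; rewrite !mxE; lra.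
by rewrite !QE !(RJ Ap).
Unshelve. all: by end_near.
Qed.

Let bracket_relation p : A p -> forall k l n x,
  rho p k l n x + 2 *: (phi p (L p k l) n x + phi p l (L p k n) x) = 0.
Proof.
move=> Ap.
apply: (rho_eq_derivation (gJ Ap) (hb Ap) (M := M p)).
- exact: M_adj.
- exact: (ricci_aphi (gJ Ap) (hb Ap) (M_adj Ap) (TE Ap) (ricci Ap)).
- exact: cocycle.
Qed.

Let relation_derivative p : A p -> forall k l n x b,
  phi p k (phi p l n x) b + L p k (dphi (L p) (N p) (M p) b l n x)
  + dphi (L p) (N p) (M p) b l n (N p k x) + phi p l n (M p b k x)
  + 2 *: (dphi (L p) (N p) (M p) b (L p k l) n x + phi p (phi p k l b) n x
    + dphi (L p) (N p) (M p) b l (L p k n) x + phi p l (phi p k n b) x) = 0.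
Proof.
move=> Ap k l n x b.
have [Fk Ek ck] := covd_parallel (bG p) (p := p) k.
have [Fl El cl] := covd_parallel (bG p) (p := p) l.
have [Fn En cn] := covd_parallel (bG p) (p := p) n.
have [Fx Ex cx] := covd_parallel (bG p) (p := p) x.
have c := covdD (bG p) (covdD (bG p)
  (covd_tensor (tL Ap) ck (cphi Ap cl cn cx))
  (cphi Ap cl cn (covd_tensor (tN Ap) ck cx)))
  (covdZ (bG p) 2 (covdD (bG p) (cphi Ap (covd_tensor (tL Ap) ck cl) cn cx)
    (cphi Ap cl (covd_tensor (tL Ap) ck cn) cx))).
have z := covd_near0 (bG p) _ c b.
have {}z := z _; rewrite /= Ek El En Ex in z.
have [z1 z2 z3] := phi0 Ap.
rewrite !(z1, z2, z3, bil0l (bL Ap), bil0r (bL Ap), bil0l (bN Ap),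
  bil0r (bN Ap), addr0) in z.
rewrite !(bilZl (bL Ap), bilZr (bL Ap)) in z.
rewrite !(phiZ1 (gJ Ap) (hb Ap), phiZ2 (gJ Ap) (hb Ap), phiZ3 (gJ Ap) (hb Ap)) in z.
apply: third; rewrite -[RHS]z.
  by apply/rowP => s; rewrite !mxE; lra.
near=> y; have Ay : A y by near: y; exact: open_nbhs_nbhs.
by rewrite -rhoE; exact: bracket_relation.
Unshelve. all: by end_near.
Qed.

Lemma phi_parallel p : A p -> forall i j n, phi p i j n = 0.
Proof.
move=> Ap; have [e eP] := orthonormal_frame (gJ Ap).
apply: (phi_eq0 (gJ Ap) eP (hb Ap) (M_adj Ap) (bracket_relation Ap)).
move=> k l n x.
apply: (commutator_rho (gJ Ap) (hb Ap) (M_adj Ap)).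
- exact: (ricci_aphi (gJ Ap) (hb Ap) (M_adj Ap) (TE Ap) (ricci Ap)).
- exact: cocycle.
- exact: relation_derivative.
Qed.

End ParallelTorsion.

(** * The 4-form Jac *)

Section FourForms.
Context {R : realType} {U : lmodType R} {g : U -> U -> R} {J : U -> U}.
Context (gJ : hermitian_space g J).
Context {T : U -> U -> U} (tT : skew_torsion g J T).
Let bT := stB tT.
Let Dg := (hgDl gJ, hgDr gJ, hgNl gJ, hgNr gJ, hgZl gJ, hgZr gJ).

Lemma jac_swap x y z : jac T y x z = - jac T x y z.
Proof.
rewrite /jac (st_skew tT x y) (st_skew tT y z) (st_skew tT z x).
rewrite !(bilNl bT); apply: (hg_inj gJ) => w; rewrite !Dg; lra.
Qed.

Lemma jac_rot x y z : jac T y z x = jac T x y z.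
Proof. by rewrite /jac addrC addrA. Qed.

Lemma jac_form_skew x y z w : g (jac T x y w) z = - g (jac T x y z) w.
Proof.
rewrite /jac !Dg !(st_rot gJ tT (T _ _)).
rewrite (hgC gJ (T x z)) (hgC gJ (T y z)).
by rewrite (st_skew tT z w) (st_skew tT w x) (st_skew tT x z) !Dg; lra.
Qed.

(** By total skewness, moving J between any two slots of the 4-form changes the sign. Carrying it
    around three slots changes the sign three times and returns to the start. *)
Lemma jac_J_linear_eq0 :
  (forall x y z, jac T x y (J z) = J (jac T x y z)) ->
  forall x y z, jac T x y z = 0.
Proof.
move=> jJ.
have J3 a b c d : g (jac T a b (J c)) d = - g (jac T a b c) (J d).
  by rewrite jJ (hgJr gJ) opprK.
have J2 a b c d : g (jac T a (J b) c) d = - g (jac T a b c) (J d).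
  by rewrite (jac_rot c) J3 -(jac_rot c).
have z3 a b c d : g (jac T a b (J c)) d = 0.
  have := J2 a b c d; rewrite (jac_form_skew _ _ d) J2 (jac_form_skew _ _ (J c)).
  by rewrite J3; lra.
move=> x y z; apply: (hg_inj gJ) => w; rewrite (hg0l gJ).
by have := z3 x y z (J w); rewrite J3 (hJJ gJ) (hgNr gJ) opprK.
Qed.

(** By skewness, a value on the four vectors depends, up to sign, only on which one comes first. The
    cyclic relations on the four triples form a nonsingular system in these four numbers. *)
Lemma cyclic_skew_eq0 (f : U -> U -> U -> U -> R) :
  (forall x y z w, f x z y w = - f x y z w) ->
  (forall x y z w, f x y w z = - f x y z w) ->
  (forall x y z w, f x y z w + f y z x w + f z x y w = 0) ->
  forall x y z w, f x y z w = 0.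
Proof.
move=> s1 s2 c x y z w.
have := c x y z w; have := c x y w z; have := c x z w y; have := c y z w x.
have -> : f y z x w = - f y x z w by rewrite s1.
have -> : f x y w z = - f x y z w by rewrite s2.
have -> : f y w x z = f y x z w by rewrite s1 s2 opprK.
have -> : f x z w y = f x y z w by rewrite s2 s1 opprK.
have -> : f z w x y = f z x y w by rewrite s1 s2 opprK.
have -> : f w x z y = - f w x y z by rewrite s2.
have -> : f y z w x = f y x z w by rewrite s2 s1 opprK.
have -> : f z w y x = - f z x y w by rewrite s1 s2 s1 opprK.
have -> : f w y z x = f w x y z by rewrite s2 s1 opprK.
lra.
Qed.

(** The cyclic sum of Jac is 3 Jac, so [K - c Jac] has zero cyclic sum; it is also skew in its last
    three slots. *)
Lemma cyclic_skew (c : R) (K : U -> U -> U -> U) :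
  (forall a, skew_torsion g J (K a)) ->
  (forall x y z, K x y z + K y z x + K z x y = (3 * c) *: jac T x y z) ->
  forall x y z, K x y z = c *: jac T x y z.
Proof.
move=> tK cK x y z; apply/eqP; rewrite -subr_eq0; apply/eqP.
apply: (hg_inj gJ) => w; rewrite (hg0l gJ).
apply: (cyclic_skew_eq0 (f := fun x y z w => g (K x y z - c *: jac T x y z) w)).
- move=> a b d e; rewrite (st_skew (tK a) b d) -(jac_rot a d b).
  by rewrite (jac_swap b d) (jac_rot a b d) !Dg; lra.
- move=> a b d e; rewrite !(hgDl gJ (K _ _ _)) !(hgNl gJ) !(hgZl gJ).
  by rewrite jac_form_skew (st_skewr (tK a)); lra.
move=> a b d e; have := congr1 (fun r => g r e) (cK a b d).
rewrite (jac_rot a) -(jac_rot d a) (hgDl gJ _ (K _ _ _)) (hgDl gJ (K _ _ _)).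
by rewrite !(hgDl gJ (K _ _ _)) !(hgNl gJ) !(hgZl gJ); lra.
Qed.

End FourForms.

(* [Theta] in the notation of the header. *)
Definition shift_defect (R : realType) (m : nat)
    (G : 'rV[R]_m -> 'rV[R]_m -> 'rV[R]_m -> 'rV[R]_m) x u v w :=
  dtors G x u v w - dtors G x v u w + jac (ltors G x) u v w.

(** * The two implications for a connection on an open set *)

Section StromingerLocal.
Context {R : realType} {m : nat}.
Local Notation E := 'rV[R]_m.
Context {A : set E} (oA : open A) {G : E -> E -> E -> E}.
Context (bG : forall x, bilinear2 (G x)).
Context (dG : forall u v x, A x -> differentiable (fun y => G y u v) x).
Context {g : E -> E -> E -> R} {J : E -> E}.
Context (gJ : forall x, A x -> hermitian_space (g x) J).
Context (lJ : lmap J).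
Context (GJ : forall x, A x -> forall a u, G x a (J u) = J (G x a u)).
Local Notation T := (ltors G).
Local Notation K := (dtors G).
Local Notation C := (lcurv G).
Local Notation shift_defect := (shift_defect G).
Context (tT : forall x, A x -> skew_torsion (g x) J (T x)).
Context (tK : forall x, A x -> forall a, skew_torsion (g x) J (K x a)).

Lemma curvatureJ x : A x -> forall u v w, C x u v (J w) = J (C x u v w).
Proof.
move=> Ax u v w; rewrite /lcurv (hJD (gJ Ax)) (hJN (gJ Ax)).
have H a b : hess G x a b (J w) = J (hess G x a b w).
  have [_ cH] := covd_lmap lJ (GJ Ax) (covd_hess dG b w Ax).
  apply: etrans _ (cH a); apply: congr2 (congr1 (G x a) (GJ Ax _ _)).
  by apply: near_eq_derive; apply: (near_open oA Ax) => y Ay; exact: GJ.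
by rewrite !H.
Qed.

Lemma strominger_parallel :
  (forall x, A x -> forall u v w, C x u v w + C x v w u + C x w u v = 0) ->
  (forall x, A x -> forall u v w, C x (J u) (J v) w = C x u v w) ->
  forall x, A x -> (forall a u v, K x a u v = 0)
    /\ (forall u v w, jac (T x) u v w = 0).
Proof.
move=> bianchi CJ.
have KE x : A x -> forall a u v, K x a u v = - 3^-1 *: jac (T x) a u v.
  move=> Ax; apply: (cyclic_skew (gJ Ax) (tT Ax) (tK Ax)) => a u v.
  have := first_bianchi bG dG a u v Ax; rewrite (bianchi x Ax).
  move/esym/eqP; rewrite addr_eq0 => /eqP ->.
  have -> : 3 * - 3^-1 = -1 :> R by lra.
  by rewrite scaleN1r.
pose L x := hol J (T x); pose N x := adj J (T x).
pose M x a u w := 3 *: adj J (K x a) u w.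
have hb x (Ax : A x) : herm_bracket (g x) J (L x) (N x) :=
  split_herm_bracket (gJ Ax) (tT Ax).
have TE x (Ax : A x) u v : T x u v = L x u v + N x v u - N x u v :=
  split_torsion (gJ Ax) (tT Ax) u v.
have phiK x : A x -> forall a u v,
    hol J (K x a) u v = 3^-1 *: phi (L x) (N x) u v a.
  move=> Ax a u v.
  rewrite -(hol_derived (gJ Ax) (tT Ax) (tK Ax) (KE x Ax) (hb x Ax) (TE x Ax)).
  by rewrite scalerA mulVf ?scale1r.
have M_adj x : A x -> forall u v a w,
    g x (phi (L x) (N x) u v a) w = g x v (M x a u w).
  move=> Ax u v a w; rewrite /M (hgZr (gJ Ax)).
  rewrite -(adj_adjoint (gJ Ax) (tK Ax a)) (phiK _ Ax) (hgZl (gJ Ax)).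
  by rewrite mulrA mulfV ?mul1r.
have tL p : A p ->
    tensord (G p) p L (fun a u v => 3^-1 *: phi (L p) (N p) u v a).
  move=> Ap; have [bL dL eL] :=
    tensord_hol (bG p) lJ (GJ Ap) (ltors_tensord bG dG Ap).
  by split=> // a u v; rewrite -eL -phiK.
have tN p : A p -> tensord (G p) p N (fun a u v => 3^-1 *: M p a u v).
  move=> Ap; have [bL dL eL] :=
    tensord_adj (bG p) lJ (GJ Ap) (ltors_tensord bG dG Ap).
  by split=> // a u v; rewrite -eL /M scalerA mulVf ?scale1r.
have jacL x : A x -> forall u v w, jac (L x) u v w = 0.
  move=> Ax; exact: (jac_hol (gJ Ax) (tT Ax) (tK Ax) (KE x Ax) (hb x Ax) (TE x Ax)).
have phi0 := phi_parallel oA bG dG gJ hb TE M_adj tL tN jacL CJ.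
move=> x Ax.
(* [hol] of [K] is [phi / 3], and its adjoint part vanishes with it; Jac = -3 K then vanishes
   too. *)
have K0 a u v : K x a u v = 0.
  have h0 b c : hol J (K x a) b c = 0 by rewrite phiK// phi0// scaler0.
  have a0 b c : adj J (K x a) b c = 0.
    apply: (hg_inj (gJ Ax)) => w; rewrite (hgC (gJ Ax)).
    by rewrite -(adj_adjoint (gJ Ax) (tK Ax a)) h0 !(hg0l (gJ Ax)).
  by rewrite (split_torsion (gJ Ax) (tK Ax a)) h0 !a0 addr0 subr0.
split=> // u v w; have := KE x Ax u v w; rewrite K0 => /esym/eqP.
by rewrite scaler_eq0 oppr_eq0 invr_eq0 pnatr_eq0 => /eqP.
Qed.

Lemma shift_defect_eq0 x (C' : E -> E -> E -> E) : A x ->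
  (forall u v w, C' u v w = C x u v w - shift_defect x u v w) ->
  (forall u v w, C' u v w + C' v w u + C' w u v = 0) ->
  (forall u v w, C' u v (J w) = J (C' u v w)) ->
  forall u v w, shift_defect x u v w = 0.
Proof.
move=> Ax C'E bianchi C'J.
(* Writing cyc for the cyclic sum, the Bianchi identity for [C'] reads (cyc K + Jac) - (2 cyc K + 3
   Jac) = 0, that is, cyc K = -2 Jac. *)
have KE : forall a u v, K x a u v = - (2 / 3) *: jac (T x) a u v.
  apply: (cyclic_skew (gJ Ax) (tT Ax) (tK Ax)) => a u v.
  have b1 := first_bianchi bG dG a u v Ax; have b2 := bianchi a u v.
  rewrite !C'E /shift_defect in b2.
  rewrite (st_skew (tK Ax v) a u) (st_skew (tK Ax u) v a) in b2.
  rewrite (st_skew (tK Ax a) u v) (jac_rot a u v) -(jac_rot v a u) in b2.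
  move: b1 b2; move: (C x) (K x) (jac (T x)) => c k j b1 b2.
  apply/rowP => s; have := congr1 (fun r : E => r 0 s) b1.
  by have := congr1 (fun r : E => r 0 s) b2; rewrite !mxE; lra.
have sE u v w : shift_defect x u v w = - 3^-1 *: jac (T x) u v w.
  rewrite /shift_defect !KE (jac_swap (gJ Ax) (tT Ax) u v).
  move: (jac _ _ _ _) => j; apply/rowP => s; rewrite !mxE; lra.
have j0 : forall u v w, jac (T x) u v w = 0.
  apply: (jac_J_linear_eq0 (gJ Ax) (tT Ax)) => u v w.
  have := C'J u v w; rewrite !C'E curvatureJ// (hJD (gJ Ax) (C x u v w)) (hJN (gJ Ax)).
  move/addrI/oppr_inj; rewrite !sE (hJZ (gJ Ax)); apply: scalerI.
  by rewrite oppr_eq0 invr_eq0 pnatr_eq0.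
by move=> u v w; rewrite sE j0 scaler0.
Qed.

(** As [C] commutes with J, so does J Theta J. This says that Theta itself commutes with J, and then
    J Theta J = -Theta. *)
Lemma minus_plus_lcurv x (C' : E -> E -> E -> E) : A x ->
  (forall u v w, C' u v w = C x u v w + J (shift_defect x u v (J w))) ->
  (forall u v w, C' u v (J w) = J (C' u v w)) ->
  forall u v w, C' u v w = C x u v w - shift_defect x u v w.
Proof.
move=> Ax C'E C'J u v w; rewrite C'E; congr (_ + _).
have bT := ltors_bilinear bG x.
have dN : shift_defect x u v (- w) = - shift_defect x u v w.
  rewrite /shift_defect /jac.
  rewrite !(bilNr (stB (tK Ax _)), bilNr bT, bilNl bT).
  by rewrite !opprD.
have := C'J u v w; rewrite !C'E curvatureJ// (hJD (gJ Ax) (C x u v w)) => /addrI.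
by rewrite !(hJJ (gJ Ax)) dN (hJN (gJ Ax)) => /oppr_inj <-; rewrite (hJJ (gJ Ax)).
Qed.

End StromingerLocal.

(** * Levi-Civita and Chern connections relative to the Strominger connection *)

Section Contorsion.
Context {R : realType} {U : lmodType R} {g : U -> U -> R} {J : U -> U}.
Context (gJ : hermitian_space g J).
Context {T : U -> U -> U} (tT : skew_torsion g J T).
Context {h : U -> U -> U} (bh : bilinear2 h).
Hypothesis h_skew : forall a u v, g (h a u) v = - g u (h a v).
Let bT := stB tT.
Let Dg := (hgDl gJ, hgDr gJ, hgNl gJ, hgNr gJ, hgZl gJ, hgZr gJ).
Let DJ := (hJD gJ, hJN gJ, hJZ gJ, hJJ gJ).
Let DT := (bilDl bT, bilDr bT, bilNl bT, bilNr bT, bilZl bT, bilZr bT).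
Let Dh := (bilDl bh, bilDr bh, bilNl bh, bilNr bh, bilZl bh, bilZr bh).

(** Koszul's argument: [g (h a b) c] is skew in [b], [c], and its skew part in [a], [b] is
    prescribed by the 3-form. *)
Lemma levi_civita_contorsion : (forall u v, h u v - h v u = T u v) ->
  forall u v, h u v = 2^-1 *: T u v.
Proof.
move=> hT u v; apply: (hg_inj gJ) => w.
have H a b c : g (h a b) c - g (h b a) c = g (T a b) c.
  by rewrite -hT !Dg.
have sk a b c : g (h a b) c = - g (h a c) b by rewrite h_skew (hgC gJ b).
have := H u v w; have := H v w u; have := H w u v.
rewrite -(st_rot gJ tT u v w) (st_rot gJ tT w u v) (sk v w u) (sk u w v).
by rewrite (sk w v u) Dg; lra.
Qed.

Hypothesis hJ : forall a u, h a (J u) = J (h a u).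
Let T' u v := T u v - (h u v - h v u).
Hypothesis no11 : forall u v, T' u v + T' (J u) (J v) = 0.

Lemma chern_contorsion u v : h u v = 2^-1 *: (T u v - J (T u (J v))).
Proof.
pose k u v := h u v - 2^-1 *: (T u v - J (T u (J v))).
have bk : bilinear2 k.
  split=> *; apply: (hg_inj gJ) => z; rewrite /k;
  by rewrite !(DJ, DT, Dh, Dg); lra.
have kJ a b : k a (J b) = J (k a b).
  by apply: (hg_inj gJ) => z; rewrite /k !hJ !(DJ, DT, Dg); lra.
have k_skew a b c : g (k a b) c = - g b (k a c).
  rewrite /k !Dg h_skew (hgC gJ b (T _ _)) (hgJr gJ b) (hgC gJ (J b)).
  have -> : g (J (T a (J b))) c = - g (T a (J b)) (J c).
    by rewrite (hgJr gJ) opprK.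
  rewrite (st_skewr tT a c b) (st_skewr tT a (J c) (J b)).
  by rewrite -/(T a _); lra.
(* Twice the J-antilinear part of [k] in its first argument. [no11] makes it symmetric; being
   antilinear in one slot and linear in the other, it vanishes. *)
pose b u v := k u v + J (k (J u) v).
have b_sym x y : b x y = b y x.
  apply: (hg_inj gJ) => z; have := congr1 (fun r => g r z) (no11 x y).
  rewrite /b /k /T' !hJ (st_skew tT x y) (st_skew tT x (J y)).
  rewrite (st_skew tT (J x) y) (st_skew tT (J x) (J y)) (hg0l gJ).
  by rewrite !(DJ, DT, Dg); lra.
have b0 x y : b x y = 0.
  have e1 : b (J x) y = - J (b x y).
    by apply: (hg_inj gJ) => z; rewrite /b !(bilNl bk, DJ, Dg); lra.
  have e2 : b y (J x) = J (b y x).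
    by apply: (hg_inj gJ) => z; rewrite /b !(kJ, DJ, Dg); lra.
  have : J (b x y) = - J (b x y) by rewrite {1}b_sym -e2 b_sym e1.
  move/(congr1 J); rewrite !DJ => e; apply: (hg_inj gJ) => z.
  by have := congr1 (fun r => g r z) e; rewrite (hg0l gJ) !Dg; lra.
have kJl x y : k (J x) y = J (k x y).
  have /(congr1 J) := b0 x y; rewrite /b !DJ (hJ0 gJ) => /eqP.
  by rewrite subr_eq0 => /eqP <-.
suff : k u v = 0 by move/eqP; rewrite subr_eq0 => /eqP.
(* Now [k] is J-linear in both arguments. Skewness of [k (J u)] and of [k u] on [J v] gives this
   number two opposite values. *)
suff z w : g (J (k u v)) w = 0.
  apply: (hg_inj gJ) => w; rewrite (hg0l gJ).
  by have := z (J w); rewrite (hgJ gJ).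
have := k_skew (J u) v w; rewrite !kJl (hgJr gJ) opprK.
by have := k_skew u (J v) w; rewrite kJ; lra.
Qed.

End Contorsion.

(** * Connections in a chart *)

Section Smooth.
Context {R : realType} {V W : normedModType R} {A : set V} (oA : open A).

Lemma smooth_cst (w : W) : smooth A (cst w : V -> W).
Proof.
move=> k; elim: k w => [|k IH] w /=; first by move=> x _; exact: cst_continuous.
split=> [x _|v]; first exact: differentiable_cst.
apply: Ck_eq (IH 0) => // x _; by rewrite derive_cst.
Qed.

Lemma smooth_lin (f h : V -> W) a b : smooth A f -> smooth A h ->
  smooth A (fun x => a *: f x + b *: h x).
Proof. by move=> sf sh k; apply: Ck_lin. Qed.

Lemma smooth_sum I (r : seq I) (F : I -> V -> W) :
  (forall i, smooth A (F i)) -> smooth A (fun x => \sum_(i <- r) F i x).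
Proof.
move=> sF; elim: r => [|i r IH].
  by move=> k; apply: Ck_eq (smooth_cst 0 k) => // x _; rewrite big_nil.
move=> k; apply: Ck_eq (smooth_lin 1 1 (sF i) IH k) => // x _.
by rewrite big_cons !scale1r.
Qed.

Lemma smooth_scale (f : V -> W) a : smooth A f -> smooth A (fun x => a *: f x).
Proof.
move=> sf k; apply: Ck_eq (smooth_lin a 0 sf sf k) => // x _.
by rewrite scale0r addr0.
Qed.

Lemma smooth_differentiable (f : V -> W) x :
  smooth A f -> A x -> differentiable f x.
Proof. by move=> /(_ 1%N)[df _]; exact: df. Qed.

End Smooth.

Section Jmul.
Context {R : realType} {n : nat}.
Implicit Types u v : 'rV[R]_(n + n).

Lemma Jmul_lmap : lmap (@Jmul R n).
Proof.
split=> [u v|a u]; rewrite /Jmul.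
  rewrite [RHS]add_row_mx; congr row_mx; last exact: raddfD.
  by rewrite raddfD opprD.
rewrite scale_row_mx; congr row_mx; last exact: linearZ.
by rewrite linearZ scalerN.
Qed.

Lemma JmulK u : Jmul (Jmul u) = - u.
Proof.
by rewrite /Jmul row_mxKr row_mxKl -opp_row_mx hsubmxK.
Qed.

End Jmul.

Section Chart.
Context {R : realType} {n : nat} {M : topologicalType}.
Context {X : complexManifold R n M} (g : hermitianMetric X) (c : atlas X).
Local Notation E := (model R n).
Local Notation A := (cod (ch c)).
Local Notation gx x := (bilin (metric g c x)).
Implicit Types D : connection X.

Definition gam D x u v := Defs.contract (christoffel D c) x u v.

Lemma chart_hermitian x : A x -> hermitian_space (gx x) (@Jmul R n).
Proof.
move=> Ax; have [JD JZ] := @Jmul_lmap R n; split=> //.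
- by move=> u v w; rewrite /bilin !mulmxDl mxE.
- by move=> a u v; rewrite /bilin -!scalemxAl mxE.
- exact (@Defs.metric_sym _ _ _ _ g c x Ax).
- exact (@Defs.metric_pos _ _ _ _ g c x Ax).
- exact: JmulK.
- exact (@Defs.metric_J _ _ _ _ g c x Ax).
Qed.

Lemma gam_bilinear D x : bilinear2 (gam D x).
Proof.
rewrite /gam /Defs.contract; split=> *.
- rewrite -big_split; apply: eq_bigr => i _ /=; rewrite -big_split.
  by apply: eq_bigr => j _; rewrite mxE mulrDl scalerDl.
- rewrite -big_split; apply: eq_bigr => i _ /=; rewrite -big_split.
  by apply: eq_bigr => j _; rewrite mxE mulrDr scalerDl.
- rewrite scaler_sumr; apply: eq_bigr => i _ /=; rewrite scaler_sumr.
  by apply: eq_bigr => j _; rewrite mxE scalerA mulrA.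
- rewrite scaler_sumr; apply: eq_bigr => i _ /=; rewrite scaler_sumr.
  by apply: eq_bigr => j _; rewrite mxE scalerA mulrCA.
Qed.

Let oA : open A := @cod_open R n M (ch c).

Lemma gam_smooth D u v : smooth A (fun x => gam D x u v).
Proof.
apply: smooth_sum => // i; apply: smooth_sum => // j.
by apply: smooth_scale => //; exact: christoffel_smooth.
Qed.

Lemma gam_differentiable D u v x : A x ->
  differentiable (fun y => gam D y u v) x.
Proof. exact: (smooth_differentiable (gam_smooth D u v)). Qed.

Lemma cov_cstl D u (F : E -> E) x : cov D c (cst u) F x = 'D_u F x + gam D x u (F x).
Proof. by []. Qed.

Lemma cov_cst D u v : cov D c (cst u) (cst v) = (fun x => gam D x u v).
Proof. by apply/funext => x; rewrite cov_cstl derive_cst add0r. Qed.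

Lemma bracket_cst u v : bracket (cst u) (cst v) = (fun _ : E => 0 : E).
Proof. by apply/funext => x; rewrite /bracket !derive_cst subrr. Qed.

Lemma torsE D x u v : tors D c x u v = ltors (gam D) x u v.
Proof. by rewrite /tors /torsion !cov_cst bracket_cst subr0. Qed.

Lemma curvatureE D u v w x :
  curvature D c (cst u) (cst v) (cst w) x = lcurv (gam D) x u v w.
Proof.
rewrite /curvature !cov_cst bracket_cst !cov_cstl.
rewrite /cov derive0 (bil0l (gam_bilinear D x)) addr0.
exact: subr0.
Qed.

Lemma preserves_metric_gam D : preserves_metric g D ->
  forall x, A x -> forall a u v,
  'D_a (fun y => gx y u v) x = gx x (gam D x a u) v + gx x u (gam D x a v).
Proof.
move=> mD x Ax a u v.
have := mD c (cst u) (cst v) (smooth_cst oA u) (smooth_cst oA v) x Ax a.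
by rewrite !cov_cst.
Qed.

End Chart.

(** * Algebraic identities inherited by covariant derivatives *)

Section TensordFacts.
Context {R : realType} {m : nat}.
Local Notation E := 'rV[R]_m.
Context {Gp : E -> E -> E} {p : E} (bG : bilinear2 Gp).
Local Notation cd := (covd Gp p).

Lemma covd_near_eq (F F' H H' : E -> E) : cd F F' -> cd H H' ->
  (\forall x \near p, F x = H x) -> forall a, F' a = H' a.
Proof.
move=> cF cH FH a; apply/eqP; rewrite -subr_eq0; apply/eqP.
apply: (covd_near0 bG _ (covdB bG cF cH) a).
by apply: filterS FH => x ->; rewrite subrr.
Qed.

Context {B : E -> E -> E -> E} {B' : E -> E -> E -> E}.
Hypothesis tB : tensord Gp p B B'.

Lemma tensord_bilinear a : bilinear2 (B' a).
Proof.
have [bB _ _] := tB; have b := nbhs_singleton bB.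
have ns (P : E -> Prop) : (forall x, bilinear2 (B x) -> P x) ->
    \forall x \near p, P x.
  by move=> BP; apply: filterS bB.
split.
- move=> u v w; have := covd_near_eq (tensord_cst (u + v) w tB)
    (covdD bG (tensord_cst u w tB) (tensord_cst v w tB))
    (ns _ (fun x bx => bilDl bx u v w)) a.
  rewrite (bilDr bG) !(bilDl b); move: (B' a) (B p) => k t e.
  apply/rowP => j; have := congr1 (fun r : E => r 0 j) e.
  by rewrite !mxE; lra.
- move=> u v w; have := covd_near_eq (tensord_cst u (v + w) tB)
    (covdD bG (tensord_cst u v tB) (tensord_cst u w tB))
    (ns _ (fun x bx => bilDr bx u v w)) a.
  rewrite (bilDr bG) !(bilDr b); move: (B' a) (B p) => k t e.
  apply/rowP => j; have := congr1 (fun r : E => r 0 j) e.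
  by rewrite !mxE; lra.
- move=> s u v; have := covd_near_eq (tensord_cst (s *: u) v tB)
    (covdZ bG s (tensord_cst u v tB)) (ns _ (fun x bx => bilZl bx s u v)) a.
  rewrite (bilZr bG) !(bilZl b); move: (B' a) (B p) => k t e.
  apply/rowP => j; have := congr1 (fun r : E => r 0 j) e.
  by rewrite !mxE; lra.
- move=> s u v; have := covd_near_eq (tensord_cst u (s *: v) tB)
    (covdZ bG s (tensord_cst u v tB)) (ns _ (fun x bx => bilZr bx s u v)) a.
  rewrite (bilZr bG) !(bilZr b); move: (B' a) (B p) => k t e.
  apply/rowP => j; have := congr1 (fun r : E => r 0 j) e.
  by rewrite !mxE; lra.
Qed.

Lemma tensord_skew : (forall u v, \forall x \near p, B x v u = - B x u v) ->
  forall a u v, B' a v u = - B' a u v.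
Proof.
move=> sB a u v; have s w z := nbhs_singleton (sB w z).
have := covd_near_eq (tensord_cst v u tB) (covdN bG (tensord_cst u v tB))
  (sB u v) a.
rewrite (s u) (s (Gp a u)); move: (B' a) (B p) => k t e.
apply/rowP => j; have := congr1 (fun r : E => r 0 j) e.
by rewrite !mxE; lra.
Qed.

Lemma tensord_type (J : E -> E) : lmap J ->
  (forall a u, Gp a (J u) = J (Gp a u)) ->
  (forall u v, \forall x \near p,
    B x u v = B x (J u) (J v) - J (B x (J u) v) - J (B x u (J v))) ->
  forall a u v,
    B' a u v = B' a (J u) (J v) - J (B' a (J u) v) - J (B' a u (J v)).
Proof.
move=> lJ GJ yB a u v; have y w z := nbhs_singleton (yB w z).
have [JD JZ] := lJ.
have := covd_near_eq (tensord_cst u v tB) (covdB bG (covdB bG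
  (tensord_cst (J u) (J v) tB) (covd_lmap lJ GJ (tensord_cst (J u) v tB)))
  (covd_lmap lJ GJ (tensord_cst u (J v) tB))) (yB u v) a.
rewrite (y (Gp a u)) (y u (Gp a v)) !GJ !JD; move: (B' a) (B p) => k t e.
apply/rowP => j; have := congr1 (fun r : E => r 0 j) e.
by rewrite !mxE; lra.
Qed.

Lemma tensordN : tensord Gp p (fun x u v => - B x u v) (fun a u v => - B' a u v).
Proof.
have [bB _ _] := tB; apply: tensord_intro.
  apply: filterS bB => x b; split=> *;
  by rewrite ?(bilDl b, bilDr b, bilZl b, bilZr b) ?opprD ?scalerN.
move=> u v; apply: covd_ext (covdN bG (tensord_cst u v tB)) _ => a.
by rewrite !opprD.
Qed.

Lemma tensord_conj (J : E -> E) : lmap J ->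
  (forall a u, Gp a (J u) = J (Gp a u)) ->
  tensord Gp p (fun x u v => J (B x u (J v))) (fun a u v => J (B' a u (J v))).
Proof.
move=> lJ GJ; have [bB _ _] := tB; have [JD JZ] := lJ; apply: tensord_intro.
  apply: filterS bB => x b; split=> *;
  by rewrite ?(JD, JZ) ?(bilDl b, bilDr b, bilZl b, bilZr b) ?(JD, JZ).
move=> u v.
apply: covd_ext (covd_lmap lJ GJ (tensord_cst u (J v) tB)) _ => a.
by rewrite !JD !GJ.
Qed.

End TensordFacts.

(** * The Strominger torsion in a chart *)

Section StromingerChart.
Context {R : realType} {n : nat} {M : topologicalType}.
Context {X : complexManifold R n M} {g : hermitianMetric X}.
Context {St : connection X} (hSt : strominger g St) (c : atlas X).
Local Notation E := (model R n).
Local Notation A := (cod (ch c)).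
Local Notation J := (@Jmul R n).
Local Notation gx x := (bilin (metric g c x)).
Local Notation G := (gam c St).
Local Notation T := (ltors G).
Local Notation K := (dtors G).

Let oA : open A := @cod_open R n M (ch c).
Let gJ x (Ax : A x) : hermitian_space (gx x) J := chart_hermitian g Ax.

Lemma gamJ D : preserves_J D ->
  forall x, A x -> forall a u, gam c D x a (J u) = J (gam c D x a u).
Proof.
move=> jD x Ax a u.
have : cov D c (cst a) (cst (J u)) x = J (cov D c (cst a) (cst u) x).
  exact: (jD c (cst u) (smooth_cst oA u) x Ax a).
by rewrite !cov_cst.
Qed.

Let mS : preserves_metric g St. Proof. by case: hSt. Qed.
Let GJ : forall x, A x -> forall a u, G x a (J u) = J (G x a u).
Proof. by apply: gamJ; case: hSt. Qed.

Let T_skewr x : A x ->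
  forall u v w, gx x (T x u w) v = - gx x (T x u v) w.
Proof.
move=> Ax u v w; have [_ _ sS] := hSt.
by have [_] := sS c x Ax u v w; rewrite !torsE.
Qed.

Let T_skew x u v : T x v u = - T x u v.
Proof. by rewrite /ltors opprB. Qed.

(** Integrability of the complex structure: J is parallel and constant in the chart, so its
    Nijenhuis tensor, expressed through the torsion, vanishes. *)
Let T_type x : A x -> forall u v,
  T x u v = T x (J u) (J v) - J (T x (J u) v) - J (T x u (J v)).
Proof.
move=> Ax u v; have D := (hJD (gJ Ax), hJN (gJ Ax), hJJ (gJ Ax)).
rewrite /ltors !GJ // !D.
by apply/rowP => j; rewrite !mxE; lra.
Qed.

Lemma strominger_torsion x : A x -> skew_torsion (gx x) J (T x).
Proof.
by move=> Ax; split; [exact: ltors_bilinear (gam_bilinear c St) x|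
  exact: T_skew|exact: T_skewr|exact: T_type].
Qed.

Let tT x (Ax : A x) := ltors_tensord (gam_bilinear c St)
  (gam_differentiable St) Ax.

Let T_smooth u v : smooth A (fun x => T x u v).
Proof.
move=> k; apply: Ck_eq (smooth_lin oA 1 (-1) (gam_smooth c St u v)
  (gam_smooth c St v u) k) => // x _.
by rewrite scale1r scaleN1r.
Qed.

(** Each identity of [strominger_torsion] holds near [x] and is differentiated there; skewness in
    the last two slots uses Dg = 0, and the type condition uses DJ = 0. *)
Lemma strominger_dtorsion x : A x -> forall a, skew_torsion (gx x) J (K x a).
Proof.
move=> Ax a; have bG := gam_bilinear c St x.
split.
- exact (tensord_bilinear bG (tT Ax) a).
- apply: (tensord_skew bG (tT Ax)) => u v.
  by near=> y; exact: T_skew.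
- move=> u v w.
  have cv := tensord_cst u v (tT Ax).
  have cw := covdN bG (tensord_cst u w (tT Ax)).
  have e1 := mS (T_smooth u v) (smooth_cst oA w) Ax a.
  have sw : smooth A (fun y => - T y u w).
    move=> k; apply: Ck_eq (smooth_scale oA (-1) (T_smooth u w) k) => // y _.
    by rewrite scaleN1r.
  have e2 := mS sw (smooth_cst oA v) Ax a.
  have e : 'D_a (fun y => gx y (T y u v) w) x =
      'D_a (fun y => gx y (- T y u w) v) x.
    apply: near_eq_derive; apply: (near_open oA Ax) => y Ay.
    by rewrite (hgNl (gJ Ay)) T_skewr.
  have := etrans (esym e1) (etrans e e2).
  rewrite !cov_cst !cov_cstl.
  rewrite (cv.2 a) (cw.2 a) -[cst w x]/w -[cst v x]/v.
  have := T_skewr Ax (G x a u) v w; have := T_skewr Ax u (G x a v) w.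
  have := T_skewr Ax u v (G x a w).
  move: (K x a) (T x) (G x a) => k t h.
  have Dg := (hgDl (gJ Ax), hgNl (gJ Ax)); rewrite !Dg.
  by move: (gx x) => q; lra.
- apply: (tensord_type bG (tT Ax) (@Jmul_lmap R n) (GJ Ax)) => u v.
  by apply: (near_open oA Ax) => y Ay; exact: T_type.
Unshelve. all: by end_near.
Qed.

Lemma levi_civita_gam LC : levi_civita g LC -> forall x, A x ->
  forall u v, gam c LC x u v = G x u v - 2^-1 *: T x u v.
Proof.
move=> [mL tL] x Ax u v.
pose h u v := G x u v - gam c LC x u v.
have bh : bilinear2 h.
  have b := gam_bilinear c St x; have b' := gam_bilinear c LC x.
  split=> *; rewrite /h ?(bilDl b, bilDr b, bilZl b, bilZr b)
    ?(bilDl b', bilDr b', bilZl b', bilZr b') ?scalerBr //;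
    by rewrite opprD addrACA.
have := levi_civita_contorsion (gJ Ax) (strominger_torsion Ax) (h := h) _ _ u v.
move=> <-.
- by rewrite /h opprB addrC subrK.
- move=> a b d; have e1 := preserves_metric_gam mS Ax a b d.
  have := etrans (esym e1) (preserves_metric_gam mL Ax a b d).
  rewrite /h !(hgDl (gJ Ax)) !(hgDr (gJ Ax)) !(hgNl (gJ Ax)) !(hgNr (gJ Ax)).
  by move: (gx x) => k; lra.
- move=> a b; have := tL c x Ax a b; rewrite torsE /ltors => /eqP.
  rewrite subr_eq0 => /eqP e; rewrite /h e.
  by apply/rowP => j; rewrite !mxE; lra.
Qed.

Lemma chern_gam Ch : chern g Ch -> forall x, A x -> forall u v,
  gam c Ch x u v = G x u v - 2^-1 *: (T x u v - J (T x u (J v))).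
Proof.
move=> [mC jC tC] x Ax u v.
pose h u v := G x u v - gam c Ch x u v.
have bh : bilinear2 h.
  have b := gam_bilinear c St x; have b' := gam_bilinear c Ch x.
  split=> *; rewrite /h ?(bilDl b, bilDr b, bilZl b, bilZr b)
    ?(bilDl b', bilDr b', bilZl b', bilZr b') ?scalerBr //;
    by rewrite opprD addrACA.
rewrite -(chern_contorsion (gJ Ax) (strominger_torsion Ax) bh).
- by rewrite /h opprB addrC subrK.
- move=> a b d; have e1 := preserves_metric_gam mS Ax a b d.
  have := etrans (esym e1) (preserves_metric_gam mC Ax a b d).
  rewrite /h !(hgDl (gJ Ax)) !(hgDr (gJ Ax)) !(hgNl (gJ Ax)) !(hgNr (gJ Ax)).
  by move: (gx x) => k; lra.
- move=> a b; rewrite /h GJ // (gamJ jC Ax).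
  by rewrite (hJD (gJ Ax)) (hJN (gJ Ax)).
- move=> a b; have [e _] := tC c x Ax a b; move: e; rewrite !torsE /ltors /h.
  move: (G x) (gam c Ch x) => k k' e.
  by rewrite -[RHS]e; apply/rowP => j; rewrite !mxE; lra.
Qed.

End StromingerChart.

(** * Curvature of the two shifted connections *)

Section KahlerLike.
Context {R : realType} {n : nat} {M : topologicalType}.
Context {X : complexManifold R n M} {g : hermitianMetric X}.
Local Notation J := (@Jmul R n).

Definition kahler_symmetries
    (C : model R n -> model R n -> model R n -> model R n) :=
  [/\ forall u v w, C u v w + C v w u + C w u v = 0,
      forall u v w, C (J u) (J v) w = C u v w &
      forall u v w, C u v (J w) = J (C u v w)].

(** Nondegeneracy of [g] makes the conditions vector-valued. [C] is a parameter so that the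
    curvatures of the shifted connections can be entered through that of the Strominger
    connection. *)
Lemma kahler_likeP (D : connection X)
    (C : atlas X -> model R n -> model R n -> model R n -> model R n -> model R n) :
  (forall c x, cod (ch c) x -> forall u v w,
    lcurv (gam c D) x u v w = C c x u v w) ->
  kahler_like g D <->
  preserves_metric g D /\
  forall c x, cod (ch c) x -> kahler_symmetries (C c x).
Proof.
move=> CE; split=> -[mD kD]; (split; first exact: mD) => c x Ax;
  have gJ := chart_hermitian g Ax;
  have curvE u v w z : curv g D c x u v w z =
    bilin (metric g c x) (C c x u v w) z by rewrite /curv curvatureE CE.
  split=> u v w; apply: (hg_inj gJ) => z.
  - have [+ _ _] := kD c x Ax u v w z.
    by rewrite !curvE !(hgDl gJ) (hg0l gJ).
  - by have [_ + _] := kD c x Ax u v w z; rewrite !curvE.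
  - have [_ _ +] := kD c x Ax u v w (J z).
    rewrite !curvE (hJJ gJ) (hgNr gJ) (hgJr gJ) => /oppr_inj e.
    by rewrite e.
move=> u v w z; have [b k1 k2] := kD c x Ax; rewrite !curvE; split.
- by rewrite -!(hgDl gJ) b (hg0l gJ).
- by rewrite k1.
- by rewrite k2 (hgJ gJ).
Qed.

Lemma gam_affine s (D0 D1 : connection X) c x u v :
  gam c (affine s D0 D1) x u v =
  (1 - s) *: gam c D0 x u v + s *: gam c D1 x u v.
Proof. exact: contract_lin. Qed.

Context {St : connection X} (hSt : strominger g St).

Section Shift.
Context (c : atlas X).
Local Notation A := (cod (ch c)).
Local Notation G := (gam c St).
Local Notation T := (ltors G).
Local Notation K := (dtors G).

Lemma shift_preserves_metric (D : connection X)
    (B : atlas X -> model R n -> model R n -> model R n -> model R n) :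
  (forall c x, cod (ch c) x -> forall u v,
    gam c D x u v = gam c St x u v + B c x u v) ->
  (forall c x, cod (ch c) x -> forall a u v,
    bilin (metric g c x) (B c x a u) v = - bilin (metric g c x) u (B c x a v)) ->
  preserves_metric g D.
Proof.
move=> DE Bs d Y Z sY sZ x Ax u; have [mS _ _] := hSt.
have gJ := chart_hermitian g Ax.
rewrite (mS d Y Z sY sZ x Ax u) !cov_cstl !DE // !addrA.
rewrite (hgDl gJ _ (B _ _ _ _)) (hgDr gJ _ _ (B _ _ _ _)) Bs //.
by rewrite addrACA addNr addr0.
Qed.

Lemma lcurv_shift (D : connection X) B B' x : A x ->
  (forall y, A y -> forall u v, gam c D y u v = G y u v + B y u v) ->
  tensord (G x) x B B' -> forall u v w,
  lcurv (gam c D) x u v w =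
  lcurv G x u v w + B' u v w - B' v u w + B x (T x u v) w
  + B x u (B x v w) - B x v (B x u w).
Proof.
move=> Ax DE tB u v w.
rewrite -(curvature_shift (gam_bilinear c St) (gam_differentiable St) _ _ _ Ax tB).
have H a b : hess (gam c D) x a b w =
    'D_a (fun y => G y b w + B y b w) x
    + (G x a (G x b w + B x b w) + B x a (G x b w + B x b w)).
  have e1 : 'D_a (fun y => gam c D y b w) x = 'D_a (fun y => G y b w + B y b w) x.
    apply: near_eq_derive; apply: (near_open (@cod_open R n M (ch c)) Ax) => y Ay.
    exact: DE.
  have e2 : gam c D x a (gam c D x b w) =
      G x a (G x b w + B x b w) + B x a (G x b w + B x b w).
    by rewrite (DE x Ax a) (DE x Ax b).
  exact (congr2 +%R e1 e2).
exact: (congr2 (fun r s => r - s) (H u v) (H v u)).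
Qed.

Context {LC Ch : connection X} (hLC : levi_civita g LC) (hCh : chern g Ch).

Lemma nabla_plus_gam x : A x -> forall u v,
  gam c (nabla_plus LC St) x u v = G x u v + - T x u v.
Proof.
move=> Ax u v; rewrite gam_affine (levi_civita_gam hSt hLC) //.
by move: (G x) (T x) => k t; apply/rowP => j; rewrite !mxE; lra.
Qed.

(** The Chern connection is D - (T - J T(., J.)) / 2; in its double minus D - T the plain torsion
    cancels. *)
Lemma nabla_minus_gam x : A x -> forall u v,
  gam c (nabla_minus LC Ch St) x u v = G x u v + J (T x u (J v)).
Proof.
move=> Ax u v; rewrite gam_affine nabla_plus_gam // (chern_gam hSt hCh) //.
by move: (G x) (T x) => k t; apply/rowP => j; rewrite !mxE; lra.
Qed.

Lemma nabla_plus_lcurv x : A x -> forall u v w,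
  lcurv (gam c (nabla_plus LC St)) x u v w =
  lcurv G x u v w - shift_defect G x u v w.
Proof.
move=> Ax u v w.
have bG := gam_bilinear c St x.
have tB := tensordN bG (ltors_tensord (gam_bilinear c St)
  (gam_differentiable St) Ax).
have sT := strominger_torsion hSt Ax; have bT := stB sT.
rewrite (lcurv_shift Ax nabla_plus_gam tB) /shift_defect /jac.
rewrite (st_skew sT u (T x v w)) (st_skew sT u w) !(bilNr bT, bilNl bT).
rewrite (st_skew sT v (T x u w)).
move: (lcurv G x) (K x) (T x) => k q t.
by apply/rowP => j; rewrite !mxE; lra.
Qed.

Lemma nabla_minus_lcurv x : A x -> forall u v w,
  lcurv (gam c (nabla_minus LC Ch St)) x u v w =
  lcurv G x u v w + J (shift_defect G x u v (J w)).
Proof.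
move=> Ax u v w.
have bG := gam_bilinear c St x.
have gJ := chart_hermitian g Ax.
have GJ : forall a u, G x a (J u) = J (G x a u).
  by apply: gamJ => //; case: hSt.
have tB := tensord_conj (ltors_tensord (gam_bilinear c St)
  (gam_differentiable St) Ax) (@Jmul_lmap R n) GJ.
have sT := strominger_torsion hSt Ax; have bT := stB sT.
rewrite (lcurv_shift Ax nabla_minus_gam tB) /shift_defect /jac.
rewrite (st_skew sT u (T x v (J w))) (st_skew sT u (J w)) !(hJJ gJ).
rewrite !(bilNr bT, bilNl bT) (st_skew sT v (T x u (J w))).
move: (lcurv G x) (K x) (T x) => k q t; rewrite !(hJD gJ) !(hJN gJ).
by apply/rowP => j; rewrite !mxE; lra.
Qed.

End Shift.
End KahlerLike.

Theorem theorem3 (R : realType) (n : nat) (M : topologicalType)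
    (X : complexManifold R n M) (g : hermitianMetric X)
    (LC Ch St : connection X)
    (hLC : levi_civita g LC) (hCh : chern g Ch) (hSt : strominger g St) :
  (kahler_like g (nabla_plus LC St) <-> kahler_like g St) /\
  (kahler_like g (nabla_minus LC Ch St) <-> kahler_like g St).
Proof.
have mS : preserves_metric g St by case: hSt.
have GJ c x : cod (ch c) x -> forall a u,
    gam c St x a (Jmul u) = Jmul (gam c St x a u).
  by apply: gamJ; case: hSt.
have tT c := @strominger_torsion _ _ _ _ _ _ hSt c.
have tK c := @strominger_dtorsion _ _ _ _ _ _ hSt c.
have oA (c : atlas X) := @cod_open R n M (ch c).
pose S c x u v w := lcurv (gam c St) x u v w.
pose P c x u v w := S c x u v w - shift_defect (gam c St) x u v w.
pose Q c x u v w := S c x u v w + Jmul (shift_defect (gam c St) x u v (Jmul w)).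
have kS : kahler_like g St <-> preserves_metric g St /\
    forall c x, cod (ch c) x -> kahler_symmetries (S c x).
  exact: kahler_likeP.
have kP : kahler_like g (nabla_plus LC St) <->
    preserves_metric g (nabla_plus LC St) /\
    forall c x, cod (ch c) x -> kahler_symmetries (P c x).
  apply: kahler_likeP => c x Ax u v w.
  exact (nabla_plus_lcurv hSt hLC Ax u v w).
have kQ : kahler_like g (nabla_minus LC Ch St) <->
    preserves_metric g (nabla_minus LC Ch St) /\
    forall c x, cod (ch c) x -> kahler_symmetries (Q c x).
  apply: kahler_likeP => c x Ax u v w.
  exact (nabla_minus_lcurv hSt hLC hCh Ax u v w).
have mP : preserves_metric g (nabla_plus LC St).
  apply: (shift_preserves_metric hSt
    (B := fun c x u v => - ltors (gam c St) x u v)).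
    by move=> c x Ax u v; exact (nabla_plus_gam hSt hLC Ax u v).
  move=> c x Ax a u v; have gJ := chart_hermitian g Ax.
  by rewrite (hgNl gJ) (hgNr gJ) (hgC gJ u) (st_skewr (tT c x Ax) a v u).
have mQ : preserves_metric g (nabla_minus LC Ch St).
  apply: (shift_preserves_metric hSt
    (B := fun c x u v => Jmul (ltors (gam c St) x u (Jmul v)))).
    by move=> c x Ax u v; exact (nabla_minus_gam hSt hLC hCh Ax u v).
  move=> c x Ax a u v; have gJ := chart_hermitian g Ax.
  rewrite (hgJr gJ) opprK (hgC gJ (Jmul u)) (st_skewr (tT c x Ax)).
  by rewrite -[LHS]opprK -(hgJr gJ).
(* Here the identities are needed on the whole image of the chart, since they get differentiated;
   [from_plus] uses those of [P] only at the point [x]. *)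
have defect0 : (forall c x, cod (ch c) x -> kahler_symmetries (S c x)) ->
    forall c x, cod (ch c) x ->
    forall u v w, shift_defect (gam c St) x u v w = 0.
  move=> kSc c x Ax u v w.
  have bianchi y : cod (ch c) y -> forall u v w,
      S c y u v w + S c y v w u + S c y w u v = 0.
    by move=> Ay; case: (kSc c y Ay).
  have SJ y : cod (ch c) y -> forall u v w,
      S c y (Jmul u) (Jmul v) w = S c y u v w.
    by move=> Ay; case: (kSc c y Ay).
  have [K0 j0] := strominger_parallel (oA c) (gam_bilinear c St)
    (gam_differentiable St) (@chart_hermitian _ _ _ _ g c)
    (@Jmul_lmap R n) (GJ c) (tT c) (tK c) bianchi SJ Ax.
  by rewrite /shift_defect !K0 j0 subrr addr0.
have from_plus : (forall c x, cod (ch c) x -> kahler_symmetries (P c x)) ->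
    kahler_like g St.
  move=> kPc; apply/kS; split=> [|c x Ax]; first exact: mS.
  have [b kJJ kJ] := kPc c x Ax.
  have d0 := shift_defect_eq0 (oA c) (gam_bilinear c St)
    (gam_differentiable St) (@chart_hermitian _ _ _ _ g c) (@Jmul_lmap R n)
    (GJ c) (tT c) (tK c) Ax (fun _ _ _ => erefl) b kJ.
  have PS u v w : P c x u v w = S c x u v w by rewrite /P d0 subr0.
  split=> u v w; first by rewrite -!PS.
    by rewrite -!PS.
  by rewrite -!PS.
split; split.
- by move/kP => [_ kPc]; exact: from_plus.
- move/kS => [_ kSc]; apply/kP; split=> [|c x Ax]; first exact: mP.
  have [b kJJ kJ] := kSc c x Ax.
  have PS u v w : P c x u v w = S c x u v w by rewrite /P defect0// subr0.
  by split=> u v w; rewrite !PS.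
- move/kQ => [_ kQc]; apply: from_plus => c x Ax.
  have [b kJJ kJ] := kQc c x Ax.
  have QP : forall u v w, Q c x u v w = P c x u v w :=
    minus_plus_lcurv (oA c) (gam_bilinear c St) (gam_differentiable St)
    (@chart_hermitian _ _ _ _ g c) (@Jmul_lmap R n) (GJ c) (tK c)
    Ax (fun _ _ _ => erefl) kJ.
  by split=> u v w; rewrite -!QP.
- move/kS => [_ kSc]; apply/kQ; split=> [|c x Ax]; first exact: mQ.
  have [b kJJ kJ] := kSc c x Ax.
  have J0 := hJ0 (chart_hermitian g Ax).
  have QS u v w : Q c x u v w = S c x u v w by rewrite /Q defect0// J0 addr0.
  by split=> u v w; rewrite !QS.
Qed.
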